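(* Let $\mathcal X$ be a complex Banach space and let $A,B\in B(\mathcal X)$. For $C\in B(\mathcal X)$ let $M_C=\begin{pmatrix} A & C\\ 0 & B\end{pmatrix}$ acting on $\mathcal X\oplus\mathcal X$, and let $M_0=A\oplus B$. Suppose that at least one of the following holds: (i) $A$ has SVEP at every $\lambda\in\sigma_w(M_0)\setminus\sigma_{SF_+}(A)$ and $B$ has SVEP at every $\mu\in\sigma_w(M_0)\setminus\sigma_{SF_-}(B)$; (ii) both $A$ and $A^*$ have SVEP at every $\lambda\in\sigma_w(M_0)\setminus\sigma_{SF_+}(A)$; (iii) $A^*$ has SVEP at every $\lambda\in\sigma_w(M_0)\setminus\sigma_{SF_+}(A)$ and $B^*$ has SVEP at every $\mu\in\sigma_w(M_0)\setminus\sigma_{SF_-}(B)$. Then $M_C$ satisfies Weyl's theorem for every $C\in B(\mathcal X)$ if and only if $M_0$ satisfies Weyl's theorem and, for every $C\in B(\mathcal X)$, $A$ is polaroid at every $\lambda\in\pi_0(M_C)$.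
   Context: $B(\mathcal Y)$ is the algebra of bounded linear operators on a complex Banach space $\mathcal Y$; $T^*$ is the adjoint of $T$ acting on the dual space; $\sigma(T)$ is the spectrum and $\mathrm{iso}\,\sigma(T)$ its set of isolated points. For $T\in B(\mathcal Y)$: $\alpha(T)=\dim T^{-1}(0)$, $\beta(T)=\dim(\mathcal Y/T\mathcal Y)$. $T$ is upper (resp. lower) semi-Fredholm at $\lambda\in\mathbb C$, written $\lambda\in\Phi_+(T)$ (resp. $\lambda\in\Phi_-(T)$), if $(T-\lambda)\mathcal Y$ is closed and $\alpha(T-\lambda)<\infty$ (resp. $\beta(T-\lambda)<\infty$). The upper and lower semi-Fredholm spectra are $\sigma_{SF_+}(T)=\{\lambda:\lambda\notin\Phi_+(T)\}$ and $\sigma_{SF_-}(T)=\{\lambda:\lambda\notin\Phi_-(T)\}$. $T$ is Fredholm at $\lambda$ if $\lambda\in\Phi_+(T)\cap\Phi_-(T)$, and Weyl at $\lambda$ if in addition $\mathrm{ind}(T-\lambda)=\alpha(T-\lambda)-\beta(T-\lambda)=0$; $\sigma_w(T)=\{\lambda\in\mathbb C:T\text{ is not Weyl at }\lambda\}$. $\pi_0(T)=\{\lambda\in\mathrm{iso}\,\sigma(T):0<\alpha(T-\lambda)<\infty\}$. $T$ satisfies Weyl's theorem if $\sigma(T)\setminus\sigma_w(T)=\pi_0(T)$. The ascent $\mathrm{asc}(T-\lambda)$ is the least integer $n\ge 0$ with $\ker(T-\lambda)^n=\ker(T-\lambda)^{n+1}$, and the descent $\mathrm{dsc}(T-\lambda)$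 is the least integer $n\ge 0$ with $(T-\lambda)^n\mathcal Y=(T-\lambda)^{n+1}\mathcal Y$ (each is $\infty$ if no such $n$ exists). $T$ is polaroid at $\lambda$ if $\mathrm{asc}(T-\lambda)=\mathrm{dsc}(T-\lambda)<\infty$ (this holds automatically, with value $0$, when $\lambda\notin\sigma(T)$). $T$ has SVEP (the single-valued extension property) at $\lambda_0\in\mathbb C$ if for every open disc $\mathcal D$ centered at $\lambda_0$ the only analytic function $f:\mathcal D\to\mathcal Y$ with $(T-\lambda)f(\lambda)=0$ for all $\lambda\in\mathcal D$ is $f\equiv 0$. *)

(* Defs.v *)
Set Warnings "-notation-overridden,-ambiguous-paths,-notation-incompatible-prefix".
Set Warnings "-redundant-canonical-projection,-projection-no-head-constant".
From HB Require Import structures.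
From mathcomp Require Import all_boot all_order all_algebra.
From mathcomp Require Import complex.
From mathcomp Require Import all_classical all_reals all_analysis.

Set Implicit Arguments.
Unset Strict Implicit.
Unset Printing Implicit Defensive.

Import Order.TTheory GRing.Theory Num.Theory.
Import numFieldNormedType.Exports.

Local Open Scope classical_set_scope.
Local Open Scope ring_scope.
Local Open Scope complex_scope.

(* complex.v already makes R[i] a module over itself; this adds the norm and
   topology of R[i]^o, so that R[i] serves as scalar field and codomain. *)
HB.instance Definition _ (R : realType) := NormedModule.copy R[i] R[i]^o.

Section BoundedOperators.
Variables (R : realType) (U V : normedModType R[i]).

(* For linear maps continuous means bounded (linear_bounded_continuous). *)
Definition bounded_linear : {pred U -> V} :=
  fun f => `[< linear f /\ continuous f >].

Record bop := Bop { bop_fun :> U -> V; _ : bop_fun \in bounded_linear }.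

HB.instance Definition _ := [isSub for bop_fun].
HB.instance Definition _ := [Choice of bop by <:].

Lemma bounded_linear_submod : submod_closed bounded_linear.
Proof.
split=> [|a f g].
  apply/asboolP; split=> [a x y|]; first by rewrite scaler0 addr0.
  exact: cst_continuous.
move=> /asboolP[lf cf] /asboolP[lg cg]; apply/asboolP; split=> [b x y|x].
  rewrite /= -[RHS]/(b *: (a *: f x + g x) + (a *: f y + g y)).
  rewrite -[LHS]/(a *: f (b *: x + y) + g (b *: x + y)).
  by rewrite lf lg !scalerDr !scalerA (mulrC a b) addrACA.
by apply: cvgD; [apply: cvgZl_tmp; exact: cf | exact: cg].
Qed.

HB.instance Definition _ := GRing.isSubmodClosed.Build _ _ bounded_linear
  bounded_linear_submod.
HB.instance Definition _ := [SubChoice_isSubLmodule of bop by <:].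

Lemma bop_linear (f : bop) : linear f.
Proof. by case: f => f /= /asboolP[]. Qed.

Lemma bop_continuous (f : bop) : continuous f.
Proof. by case: f => f /= /asboolP[]. Qed.

HB.instance Definition _ (f : bop) :=
  GRing.isLinear.Build R[i] U V *:%R f (@bop_linear f).

Definition opnorm (f : bop) : R[i] :=
  (sup [set complex.Re `|f x| | x in [set x | `|x| <= 1]])%:C.

Lemma Re_normK (W : normedModType R[i]) (x : W) : (complex.Re `|x|)%:C = `|x|.
Proof. by rewrite RRe_real// ger0_real. Qed.

Lemma opnorm_has_sup (f : bop) :
  has_sup [set complex.Re `|f x| | x in [set x | `|x| <= 1]].
Proof.
split; first by exists (complex.Re `|f 0|), 0 => //=; rewrite normr0 ler01.
have /bounded_funP/(_ 1)[M fM] :=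
  continuous_linear_bounded 0 (@bop_continuous f 0).
exists (complex.Re M) => _ [x /= x1 <-].
by move: (fM x x1); rewrite lecE => /andP[].
Qed.

Lemma opnorm_unit (f : bop) (x : U) : `|x| <= 1 -> `|f x| <= opnorm f.
Proof.
move=> x1; rewrite -Re_normK lecR.
by apply: ub_le_sup; [case: (opnorm_has_sup f)|exists x].
Qed.

Lemma opnorm_le (f : bop) (M : R[i]) : 
  (forall x, `|x| <= 1 -> `|f x| <= M) -> opnorm f <= M.
Proof.
move=> fM.
have M0 : 0 <= M by apply: le_trans (fM 0 _) => //; rewrite normr0 ler01.
rewrite /opnorm -(RRe_real (ger0_real M0)) lecR.
apply: ge_sup; first by case: (opnorm_has_sup f).
move=> _ [x /= x1 <-].
by move: (fM x x1); rewrite lecE => /andP[].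
Qed.

Lemma opnorm_ge0 (f : bop) : 0 <= opnorm f.
Proof. by apply: le_trans (opnorm_unit f (x := 0) _); rewrite ?normr0 ?ler01. Qed.

Lemma opnormP (f : bop) (x : U) : `|f x| <= opnorm f * `|x|.
Proof.
have [->|x0] := eqVneq x 0; first by rewrite linear0 !normr0 mulr0.
have nx0 : 0 < `|x| by rewrite normr_gt0.
rewrite -ler_pdivrMr// mulrC.
have := @opnorm_unit f (`|x|^-1 *: x).
rewrite linearZ !normrZ normfV normr_id mulVf ?gt_eqF//; exact.
Qed.

Lemma opnormD (f g : bop) : opnorm (f + g) <= opnorm f + opnorm g.
Proof.
apply: opnorm_le => x x1; apply: le_trans (ler_normD _ _) _.
by apply: lerD; exact: opnorm_unit.
Qed.

Lemma opnormZ (a : R[i]) (f : bop) : opnorm (a *: f) = `|a| * opnorm f.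
Proof.
have leZ b (g : bop) : opnorm (b *: g) <= `|b| * opnorm g.
  apply: opnorm_le => x x1.
  by rewrite [X in `|X|](_ : _ = b *: g x)// normrZ ler_wpM2l// opnorm_unit.
apply/le_anti; rewrite leZ /=.
have [->|a0] := eqVneq a 0; first by rewrite normr0 mul0r opnorm_ge0.
rewrite -ler_pdivlMl ?normr_gt0// -normfV.
by apply: le_trans (leZ _ _); rewrite scalerA mulVf// scale1r.
Qed.

Lemma opnorm0_eq0 (f : bop) : opnorm f = 0 -> f = 0.
Proof.
move=> f0; apply/val_inj/funext => x.
by apply/eqP; rewrite -normr_le0; apply: le_trans (opnormP f x) _; rewrite f0 mul0r.
Qed.

HB.instance Definition _ :=
  Lmodule_isNormed.Build R[i] bop opnormD opnormZ opnorm0_eq0.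

End BoundedOperators.

Section Operators.
Variable R : realType.
Implicit Types U V W : normedModType R[i].

Lemma bop_of_bound_subproof U V (f : U -> V) (M : R[i]) :
  linear f -> (forall x, `|f x| <= M * `|x|) -> f \in @bounded_linear R U V.
Proof.
move=> lf fM; apply/asboolP; split=> //.
pose g : {linear U -> V} := HB.pack f (GRing.isLinear.Build R[i] U V *:%R f lf).
apply/(@linear_bounded_continuous _ _ _ g)/bounded_funP => r.
exists (`|M| * `|r|) => x xr.
apply: le_trans (fM x) _; apply: le_trans (real_ler_norm _) _.
  by rewrite ger0_real// (le_trans _ (fM x)).
by rewrite normrM normr_id ler_wpM2l// (le_trans xr)// real_ler_norm// ger0_real// (le_trans _ xr).
Qed.

Lemma bop_id_subproof V : id \in @bounded_linear R V V.
Proof. by apply: (@bop_of_bound_subproof _ _ _ 1) => // x; rewrite mul1r. Qed.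

Definition bop_id V : bop V V := Bop (bop_id_subproof V).

Lemma bop_comp_subproof U V W (S : bop V W) (T : bop U V) :
  S \o T \in @bounded_linear R U W.
Proof.
apply: (@bop_of_bound_subproof _ _ _ (opnorm S * opnorm T)).
  by move=> a x y; rewrite /= !linearP.
move=> x /=; apply: le_trans (opnormP _ _) _.
by rewrite -mulrA ler_wpM2l ?opnorm_ge0// opnormP.
Qed.

Definition bop_comp U V W (S : bop V W) (T : bop U V) : bop U W :=
  Bop (bop_comp_subproof S T).

Definition dual V : normedModType R[i] := bop V R[i].

Lemma adjoint_subproof U V (T : bop U V) :
  ((fun phi : dual V => bop_comp phi T) : dual V -> dual U) \in
    @bounded_linear R (dual V) (dual U).
Proof.
apply: (@bop_of_bound_subproof _ _ _ (opnorm T)).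
  by move=> a f g; apply/val_inj.
move=> f; apply: opnorm_le => x x1 /=; apply: le_trans (opnormP _ _) _.
rewrite mulrC; apply: ler_wpM2r; first exact: opnorm_ge0.
exact: opnorm_unit.
Qed.

Definition adjoint U V (T : bop U V) : bop (dual V) (dual U) :=
  Bop (adjoint_subproof T).

Lemma upper_tri_subproof V (A C B : bop V V) :
  (fun p : V * V => (A p.1 + C p.2, B p.2)) \in
    @bounded_linear R (V * V)%type (V * V)%type.
Proof.
apply/asboolP; split=> [a [x1 x2] [y1 y2] /=|p].
  rewrite !linearP /= -[RHS]/(a *: (A x1 + C x2) + (A y1 + C y2), a *: B x2 + B y2).
  by rewrite scalerDr addrACA.
apply: cvg_pair => /=; last first.
  by apply: (@cvg_comp _ _ _ snd B _ (nbhs p.2)); [exact: cvg_snd|exact: bop_continuous].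
apply: cvgD.
  by apply: (@cvg_comp _ _ _ fst A _ (nbhs p.1)); [exact: cvg_fst|exact: bop_continuous].
by apply: (@cvg_comp _ _ _ snd C _ (nbhs p.2)); [exact: cvg_snd|exact: bop_continuous].
Qed.

(* The operator matrix with rows (A, C) and (0, B) on V (+) V, normed by the
   library's (equivalent) max norm. *)
Definition upper_tri V (A C B : bop V V) : bop (V * V)%type (V * V)%type :=
  Bop (upper_tri_subproof A C B).

End Operators.

Section Dimension.
Variables (R : realType) (V : normedModType R[i]).
Implicit Types S : set V.

Definition has_dim S (n : nat) := exists e : 'I_n -> V,
  [/\ forall i, S (e i),
      forall c : 'I_n -> R[i], \sum_i c i *: e i = 0 -> forall i, c i = 0 &
      forall v, S v -> exists c : 'I_n -> R[i], v = \sum_i c i *: e i].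

(* dim (V / S) = n: the classes of the e i form a basis of the quotient. *)
Definition has_codim S (n : nat) := exists e : 'I_n -> V,
  (forall c : 'I_n -> R[i], S (\sum_i c i *: e i) -> forall i, c i = 0) /\
  (forall v, exists c : 'I_n -> R[i], S (v - \sum_i c i *: e i)).

Definition finite_dim S := exists n, has_dim S n.
Definition finite_codim S := exists n, has_codim S n.

(* Junk value 0 in the infinite-dimensional case, always guarded by
   finite_dim or finite_codim below. *)
Definition dim S : nat := xget 0%N (has_dim S).
Definition codim S : nat := xget 0%N (has_codim S).

End Dimension.

Section SpectralTheory.
Variables (R : realType) (Y : normedModType R[i]).
Implicit Types (T : bop Y Y) (lambda : R[i]).

Definition sub_scalar T lambda : bop Y Y := T - lambda *: bop_id Y.

Definition ker T : set Y := [set x | T x = 0].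

Definition invertible T := exists S : bop Y Y,
  bop_comp S T = bop_id Y /\ bop_comp T S = bop_id Y.

Definition spectrum T : set R[i] :=
  [set lambda | ~ invertible (sub_scalar T lambda)].

Definition alpha T : nat := dim (ker T).
Definition beta T : nat := codim (range T).
Definition ind T : int := (alpha T)%:Z - (beta T)%:Z.

Definition upper_semi_fredholm T := closed (range T) /\ finite_dim (ker T).
Definition lower_semi_fredholm T := closed (range T) /\ finite_codim (range T).
Definition fredholm T := upper_semi_fredholm T /\ lower_semi_fredholm T.
Definition weyl T := fredholm T /\ ind T = 0.

Definition sigma_SF_plus T : set R[i] :=
  [set lambda | ~ upper_semi_fredholm (sub_scalar T lambda)].
Definition sigma_SF_minus T : set R[i] :=
  [set lambda | ~ lower_semi_fredholm (sub_scalar T lambda)].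
Definition sigma_w T : set R[i] :=
  [set lambda | ~ weyl (sub_scalar T lambda)].

Definition pi0 T : set R[i] := [set lambda | isolated (spectrum T) lambda /\
  finite_dim (ker (sub_scalar T lambda)) /\
  (0 < alpha (sub_scalar T lambda))%N].

Definition weyl_theorem T := spectrum T `\` sigma_w T = pi0 T.

Fixpoint bop_exp T n : bop Y Y :=
  if n is m.+1 then bop_comp T (bop_exp T m) else bop_id Y.

Definition is_ascent T (p : nat) :=
  ker (bop_exp T p) = ker (bop_exp T p.+1) /\
  forall q, (q < p)%N -> ker (bop_exp T q) <> ker (bop_exp T q.+1).

Definition is_descent T (p : nat) :=
  range (bop_exp T p) = range (bop_exp T p.+1) /\
  forall q, (q < p)%N -> range (bop_exp T q) <> range (bop_exp T q.+1).

Definition polaroid_at T lambda := exists p,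
  is_ascent (sub_scalar T lambda) p /\ is_descent (sub_scalar T lambda) p.

(* On an open subset of the complex plane, analytic means complex
   differentiable at every point. *)
Definition analytic_on (D : set R[i]) (f : R[i] -> Y) :=
  forall z, D z -> derivable f z 1.

Definition SVEP_at T (lambda0 : R[i]) :=
  forall r : R[i], 0 < r -> forall f : R[i] -> Y,
    analytic_on (ball lambda0 r) f ->
    (forall z, ball lambda0 r z -> sub_scalar T z (f z) = 0) ->
    forall z, ball lambda0 r z -> f z = 0.

End SpectralTheory.

(* Main.v *)
(* Put T = M_C - lambda, with diagonal entries A - lambda and B - lambda. If T is
   Weyl, then A - lambda has closed range and finite-dimensional kernel, and
   B - lambda has range of finite codimension. As soon as ker (B - lambda) or the
   cokernel of A - lambda is finite-dimensional, counting dimensions shows that both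
   entries are Fredholm with indices adding up to 0, which does not depend on C.
   Outside of this situation lambda belongs to sigma_w(M_0), and each of (i)-(iii)
   provides SVEP of B or of the adjoint of A at lambda, hence the missing
   finiteness; thus sigma_w(M_C) = sigma_w(M_0).

   The SVEP step: let S = T - lambda have range of finite codimension. For large k
   the space ker S :&: S^k X lies in the closed subspace D of all x in every S^n X,
   and S D = D. From x_0 in ker S :&: D one gets by the open mapping theorem a backward
   orbit S x_(k+1) = x_k of geometric growth, and sum_k (z - lambda)^k x_k contradicts
   SVEP unless x_0 = 0. So S is injective on some S^k X, and dim ker S <= codim S X.
   Through Hahn-Banach, the same applied to the adjoint gives codim S X <= dim ker S.

   Given sigma_w(M_C) = sigma_w(M_0): if M_C satisfies Weyl's theorem, a point of
   pi_0(M_C) is isolated in sigma(M_0) and A - lambda is Fredholm there; by the SVEP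
   step for A and its adjoint the ascent and descent are finite. Conversely, if A is
   polaroid at lambda with dim ker (A - lambda) finite, then X is the sum of a finite
   dimensional ker (A - lambda)^p and of a closed subspace mapped onto itself, so A - z
   is surjective for z near lambda, and pi_0(M_C) is contained in pi_0(M_0). *)

From HB Require Import structures.
Require Import Defs.
From mathcomp Require Import all_boot all_order all_algebra.
From mathcomp Require Import complex.
From mathcomp Require Import all_classical all_reals all_analysis.
From mathcomp Require Import ring lra zify.

Set Implicit Arguments.
Unset Strict Implicit.
Unset Printing Implicit Defensive.

Import Order.TTheory GRing.Theory Num.Theory.
Import numFieldNormedType.Exports.

Local Open Scope classical_set_scope.
Local Open Scope ring_scope.

(** * Dimension of quotient spaces *)

Section Subspaces.
Variables (K : fieldType) (E : lmodType K).
Implicit Types (U V W : set E).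

(** Subspaces are predicates on sets, so that [ker] and [range], which are sets, can be used
    directly. *)
Definition subsp V := V 0 /\ forall a x y, V x -> V y -> V (a *: x + y).

Lemma subsp0 V : subsp V -> V 0. Proof. by case. Qed.

Lemma subspD V x y : subsp V -> V x -> V y -> V (x + y).
Proof. by move=> [_ h] Vx Vy; rewrite -[x]scale1r; exact: h. Qed.

Lemma subspZ V a x : subsp V -> V x -> V (a *: x).
Proof. by move=> [V0 h] Vx; rewrite -[_ *: _]addr0; exact: h. Qed.

Lemma subspN V x : subsp V -> V x -> V (- x).
Proof. by move=> sV Vx; rewrite -scaleN1r; exact: subspZ. Qed.

Lemma subspB V x y : subsp V -> V x -> V y -> V (x - y).
Proof. by move=> sV Vx Vy; apply: subspD => //; exact: subspN. Qed.

Lemma subspBK V x y : subsp V -> V (x - y) -> V y -> V x.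
Proof. by move=> sV /(subspD sV) h /h; rewrite subrK. Qed.

Lemma subsp_sum V (I : Type) (r : seq I) (P : pred I) (F : I -> E) :
  subsp V -> (forall i, V (F i)) -> V (\sum_(i <- r | P i) F i).
Proof.
move=> sV VF; elim/big_ind: _ => [|x y|i _]; [exact: subsp0|exact: subspD|exact: VF].
Qed.

Lemma subspT : subsp setT. Proof. by []. Qed.

Lemma subsp_zero : subsp [set 0].
Proof. by split=> // a x y -> ->; rewrite scaler0 addr0. Qed.

Lemma subspI U V : subsp U -> subsp V -> subsp (U `&` V).
Proof.
by move=> [U0 Ul] [V0 Vl]; split=> // a x y [? ?] [? ?]; split; [exact: Ul|exact: Vl].
Qed.

Definition sumsp U V : set E := [set x | exists2 u, U u & V (x - u)].

Lemma subsp_sumsp U V : subsp U -> subsp V -> subsp (sumsp U V).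
Proof.
move=> sU sV; split=> [|a x y [u Uu Vx] [v Uv Vy]].
  by exists 0; [exact: subsp0|rewrite subr0; exact: subsp0].
exists (a *: u + v); first by case: sU => _; apply.
by rewrite opprD addrACA -scalerBr; case: sV => _; apply.
Qed.

Lemma sumspl U V : subsp V -> U `<=` sumsp U V.
Proof. by move=> sV x Ux; exists x => //; rewrite subrr; exact: subsp0. Qed.

Lemma sumspr U V : subsp U -> V `<=` sumsp U V.
Proof. by move=> sU x Vx; exists 0; [exact: subsp0|rewrite subr0]. Qed.

Definition indep W n (e : 'I_n -> E) :=
  forall c : 'I_n -> K, W (\sum_i c i *: e i) -> forall i, c i = 0.

(* [qdim V W n] : the quotient space V / W has dimension n. *)
Definition qdim V W n := exists e : 'I_n -> E,
  [/\ forall i, V (e i), indep W e &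
      forall v, V v -> exists c : 'I_n -> K, W (v - \sum_i c i *: e i)].

Definition qfin V W := exists n, qdim V W n.

Lemma qdim_qfin V W n : qdim V W n -> qfin V W. Proof. by exists n. Qed.

(** If [m > n], the matrix of coefficients modulo [W] has a nonzero vector in its left kernel, which
    is a nontrivial relation between the [v i] modulo [W]. *)
Lemma indep_le W m n (v : 'I_m -> E) (e : 'I_n -> E) : subsp W -> indep W v ->
  (forall i, exists c : 'I_n -> K, W (v i - \sum_j c j *: e j)) -> (m <= n)%N.
Proof.
move=> sW iv /choice[a va]; rewrite leqNgt; apply/negP => ltnm.
pose A := \matrix_(i < m, j < n) a i j.
have : kermx A != 0.
  by rewrite -mxrank_eq0 mxrank_ker subn_eq0 -ltnNge (leq_ltn_trans (rank_leq_col A)).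
case/rowV0Pn => u /sub_kermxP uA0 /negP; apply.
apply/eqP/rowP => i; rewrite mxE; move: i.
apply: (iv (fun i => u 0 i)).
rewrite [X in W X](_ : _ = \sum_i u 0 i *: (v i - \sum_j a i j *: e j)).
  by apply: subsp_sum => // i; exact: subspZ.
under [RHS]eq_bigr do rewrite scalerBr.
rewrite sumrB [X in _ - X](_ : _ = 0) ?subr0//.
rewrite (eq_bigr (fun i => \sum_j (u 0 i * a i j) *: e j)); last first.
  by move=> i _; rewrite scaler_sumr; apply: eq_bigr => j _; rewrite scalerA.
rewrite exchange_big /= big1// => j _; rewrite -scaler_suml.
have /rowP/(_ j) := uA0; rewrite !mxE => uAj.
rewrite (_ : \sum_i _ = 0) ?scale0r// -[RHS]uAj.
by apply: eq_bigr => i _; rewrite mxE.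
Qed.

Lemma qdim_uniq V W m n : subsp W -> qdim V W m -> qdim V W n -> m = n.
Proof.
move=> sW [e [Ve ie se]] [f [Vf jf sf]]; apply/eqP; rewrite eqn_leq.
by apply/andP; split; [apply: (indep_le sW ie (e := f)) => i; exact: sf
                      |apply: (indep_le sW jf (e := e)) => i; exact: se].
Qed.

Lemma qdim0 V W : W 0 -> V `<=` W -> qdim V W 0.
Proof.
move=> W0 VW; exists (fun=> 0); split=> [[]//|c _ []//|v Vv].
by exists (fun=> 0); rewrite big_ord0 subr0; exact: VW.
Qed.

Lemma qdim0_sub V W : qdim V W 0 -> V `<=` W.
Proof. by move=> [e [_ _ se]] v /se[c]; rewrite big_ord0 subr0. Qed.

(** A basis of U/V followed by a basis of V/W is a basis of U/W. *)
Lemma qdim_add U V W m n : subsp V -> W `<=` V -> V `<=` U ->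
  subsp W -> qdim U V m -> qdim V W n -> qdim U W (m + n).
Proof.
move=> sV WV VU sW [e [Ue ie se]] [f [Vf jf sf]].
pose g (i : 'I_(m + n)) := match fintype.split i with inl j => e j | inr k => f k end.
have gl i : g (lshift n i) = e i.
  by rewrite /g; case: split_ordP => j /eqP; rewrite ?eq_lshift ?eq_lrshift// => /eqP <-.
have gr i : g (rshift m i) = f i.
  by rewrite /g; case: split_ordP => j /eqP; rewrite ?eq_rshift ?eq_rlshift// => /eqP <-.
have gs c : \sum_i c i *: g i =
    \sum_i c (lshift n i) *: e i + \sum_i c (rshift m i) *: f i.
  by rewrite big_split_ord /=; congr (_ + _); apply: eq_bigr => i _; rewrite ?gl ?gr.
have Vsf (c : 'I_n -> K) : V (\sum_i c i *: f i).
  by apply: subsp_sum => // i; exact: subspZ.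
exists g; split=> [i|c|v Uv].
- by rewrite /g; case: (fintype.split i) => j //; exact: VU.
- rewrite gs => Wc.
  have c1 : forall i, c (lshift n i) = 0.
    apply: (ie (fun i => c (lshift n i))).
    by have /(subspB sV (WV _ Wc)) := Vsf (fun i => c (rshift m i)); rewrite addrK.
  have c2 : forall i, c (rshift m i) = 0.
    apply: (jf (fun i => c (rshift m i))); move: Wc.
    by rewrite big1 ?add0r// => i _; rewrite c1 scale0r.
  by move=> i; case: (split_ordP i) => j ->.
- have [c Vc] := se _ Uv; have [d Wd] := sf _ Vc.
  exists (fun i => match fintype.split i with inl j => c j | inr k => d k end).
  rewrite gs [X in _ - (X + _)](_ : _ = \sum_i c i *: e i); last first.
    apply: eq_bigr => i _; case: split_ordP => j /eqP;
      by rewrite ?eq_lshift ?eq_lrshift// => /eqP ->.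
  rewrite [X in _ - (_ + X)](_ : _ = \sum_i d i *: f i) ?opprD ?addrA//.
  apply: eq_bigr => i _; case: split_ordP => j /eqP;
    by rewrite ?eq_rshift ?eq_rlshift// => /eqP ->.
Qed.

(** An independent family of maximal length exists because of the bound [N]; it spans, since a
    vector outside its span could be appended. *)
Lemma indep_qfin V W N : subsp V -> subsp W ->
  (forall n (e : 'I_n -> E), (forall i, V (e i)) -> indep W e -> (n <= N)%N) ->
  qfin V W.
Proof.
move=> sV sW bd.
pose P n := `[< exists e : 'I_n -> E, (forall i, V (e i)) /\ indep W e >].
have exP : exists n, P n.
  by exists 0%N; apply/asboolP; exists (fun=> 0); split=> [[]//|c _ []].
have bdP n : P n -> (n <= N)%N by move=> /asboolP[e [Ve ie]]; exact: bd Ve ie.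
case: (ex_maxnP exP bdP) => n /asboolP[e [Ve ie]] nmax.
exists n, e; split=> // v Vv; apply: contrapT => nv.
suff /nmax : P n.+1 by rewrite ltnn.
apply/asboolP; exists (fun i => oapp e v (unlift ord_max i)); split=> [i|c].
  by case: (unlift _ _).
rewrite big_ord_recr /= unlift_none /= => Wc.
have wE i : widen_ord (leqnSn n) i = lift ord_max i.
  by apply: val_inj; rewrite /= /bump leqNgt ltn_ord.
move: Wc; under eq_bigr do rewrite wE liftK /=.
have [c0|c0] := eqVneq (c ord_max) 0.
  rewrite c0 scale0r addr0 => /ie ic i.
  by case: (unliftP ord_max i) => [j ->|-> //]; exact: ic.
move=> Wc; exfalso; apply: nv.
(* The coefficient of [v] in the relation is nonzero, so the relation can be solved for [v]. *)
exists (fun i => - (c ord_max)^-1 * c (lift ord_max i)).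
have := subspZ (c ord_max)^-1 sW Wc.
rewrite scalerDr scalerA mulVf// scale1r addrC scaler_sumr -sumrN.
under eq_bigr do rewrite scalerA.
by under [in X in _ -> X]eq_bigr do rewrite mulNr scaleNr opprK.
Qed.

(** A family independent modulo [V] is also independent modulo [W], so families in both quotients
    have length at most [k]; finiteness comes from [indep_qfin] and the sum from [qdim_add]. *)
Lemma qdim_sub U V W k : subsp U -> subsp V -> subsp W -> W `<=` V -> V `<=` U ->
  qdim U W k -> exists m n, [/\ qdim U V m, qdim V W n & (m + n = k)%N].
Proof.
move=> sU sV sW WV VU qk; have [f [Uf jf sf]] := qk.
have [m qm] : qfin U V.
  apply: (@indep_qfin U V k) => // n e Ue ie.
  by apply: (indep_le sW (v := e) (e := f)) => [c /WV/ie//|i]; exact: sf.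
have [n qn] : qfin V W.
  apply: (@indep_qfin V W k) => // n e Ve ie.
  by apply: (indep_le sW ie (e := f)) => i; apply: sf; exact: VU.
exists m, n; split=> //.
exact: (qdim_uniq sW (qdim_add sV WV VU sW qm qn) qk).
Qed.

End Subspaces.

(** * Quotient dimensions under linear maps *)

Section Transport.
Variables (K : fieldType) (E F : lmodType K) (f : E -> F).
Hypothesis lf : linear f.
Implicit Types (V W : set E).

Let g : {linear E -> F} := HB.pack f (GRing.isLinear.Build K E F *:%R f lf).

Let f0 : f 0 = 0. Proof. exact: (linear0 g). Qed.

Let fB x y : f (x - y) = f x - f y. Proof. exact: (linearB g). Qed.

Let f_sum n (c : 'I_n -> K) e : f (\sum_i c i *: e i) = \sum_i c i *: f (e i).
Proof.
by elim/big_rec2: _ => [|i x y _ xy]; [exact: f0|rewrite lf xy].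
Qed.

Lemma subsp_image V : subsp V -> subsp (f @` V).
Proof.
move=> sV; split=> [|a _ _ [x Vx <-] [y Vy <-]].
  by exists 0; [exact: subsp0|exact: f0].
by exists (a *: x + y); [case: sV => _; apply|rewrite lf].
Qed.

Lemma subsp_preimage (V : set F) : subsp V -> subsp (f @^-1` V).
Proof.
move=> [V0 Vl]; split=> [|a x y Vx Vy]; rewrite /preimage /= ?f0//.
by rewrite lf; exact: Vl.
Qed.

(* f induces an isomorphism V / W = V' / W'. *)
Lemma qdim_iso V W (V' W' : set F) n :
  subsp W' -> (forall v, V v -> V' (f v)) ->
  (forall v', V' v' -> exists2 v, V v & W' (v' - f v)) ->
  (forall v, V v -> W' (f v) <-> W v) -> subsp V ->
  qdim V W n <-> qdim V' W' n.
Proof.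
move=> sW' VV' surj ker sV.
have Vs m (c : 'I_m -> K) e : (forall i, V (e i)) -> V (\sum_i c i *: e i).
  by move=> Ve; apply: subsp_sum => // i; exact: subspZ.
split=> [[e [Ve ie se]]|[e [Ve ie se]]].
  exists (f \o e); split=> [i|c|v' V'v'] /=.
  - exact: VV'.
  - by rewrite -f_sum => /ker; move/(_ (Vs _ _ _ Ve))/ie.
  - have [v Vv Wv] := surj _ V'v'; have [c Wc] := se _ Vv.
    exists c; rewrite -f_sum -(subrK (f v) v') -addrA -fB /=.
    apply: subspD => //; apply/ker => //; apply: subspB => //; exact: Vs.
(* For the converse, the basis of V'/W' is lifted through [f] up to errors in [W']. *)
have /choice[h hP] i : exists v, V v /\ W' (e i - f v).
  by have [v ? ?] := surj _ (Ve i); exists v.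
have Wh c : W' (\sum_i c i *: e i - f (\sum_i c i *: h i)).
  rewrite f_sum -sumrB; apply: subsp_sum => // i; rewrite -scalerBr.
  by apply: subspZ => //; have [] := hP i.
have Vh i : V (h i) by have [] := hP i.
exists h; split=> // [c Wc|v Vv].
  apply: ie; apply: subspBK (Wh c) _ => //; apply/ker => //; exact: Vs.
have [c Wc] := se _ (VV' _ Vv); exists c; apply/ker.
  by apply: subspB => //; exact: Vs.
have -> : f (v - \sum_i c i *: h i) =
    (f v - \sum_i c i *: e i) + (\sum_i c i *: e i - f (\sum_i c i *: h i)).
  by rewrite fB /= addrA subrK.
exact: subspD.
Qed.

End Transport.

Section FiniteExtension.
Variables (K : fieldType) (E : lmodType K).
Implicit Types (V W F : set E).

(** Second isomorphism theorem: (W + F)/W is isomorphic to F modulo its intersection with [W], a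
    quotient of [F]. *)
Lemma qfin_sumsp W F : subsp W -> subsp F -> qfin F [set 0] -> qfin (sumsp W F) W.
Proof.
move=> sW sF [n qn].
have sWF := subspI sW sF.
have [|x Fx|k [m [qk _ _]]] := qdim_sub sF sWF (@subsp_zero _ E) _ _ qn.
- by move=> _ ->; exact: subsp0.
- by case: Fx.
exists k; apply/(qdim_iso (f := idfun) (fun _ _ _ => erefl) (V := F) (W := W `&` F)) => //=.
- exact: sumspr.
- by move=> v [w Ww Fvw]; exists (v - w) => //; rewrite opprB addrC subrK.
- by move=> v Fv; split=> [|[]].
Qed.

End FiniteExtension.

(** * Geometric completeness and closed subspaces *)

Section RealNorm.
Variables (R : realType) (V : normedModType R[i]).
Implicit Types (x y : V) (F : set V).

(** The norm takes values in [R[i]]; its real part lives in an ordered field, where all estimates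
    below are made. *)
Definition nr x : R := complex.Re `|x|.

Lemma nrE x : `|x| = (nr x)%:C%C.
Proof. by rewrite Re_normK. Qed.

Lemma nr_le x (a : R) : (`|x| <= a%:C%C) = (nr x <= a).
Proof. by rewrite nrE lecR. Qed.

Lemma nr_lt x (a : R) : (`|x| < a%:C%C) = (nr x < a).
Proof. by rewrite nrE ltcR. Qed.

Lemma nr_ge0 x : 0 <= nr x.
Proof. by rewrite -lecR -nrE; exact: normr_ge0. Qed.

Lemma nr0 : nr 0 = 0.
Proof. by rewrite /nr normr0. Qed.

Lemma nr_eq0 x : nr x = 0 -> x = 0.
Proof. by move=> x0; apply/normr0_eq0; rewrite nrE x0. Qed.

Lemma nr_gt0 x : x != 0 -> 0 < nr x.
Proof. by move=> x0; rewrite lt_neqAle nr_ge0 andbT; apply: contra_neq x0 => /esym/nr_eq0. Qed.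

Lemma nrN x : nr (- x) = nr x.
Proof. by rewrite /nr normrN. Qed.

Lemma nrC x y : nr (x - y) = nr (y - x).
Proof. by rewrite -nrN opprB. Qed.

Lemma nrD x y : nr (x + y) <= nr x + nr y.
Proof. by rewrite -lecR rmorphD /= -!nrE ler_normD. Qed.

Lemma nr_tri x y z : nr (x - z) <= nr (x - y) + nr (y - z).
Proof. by apply: le_trans (nrD _ _); rewrite addrA subrK. Qed.

Lemma nr_small x : (forall e, 0 < e -> nr x <= e) -> x = 0.
Proof.
move=> h; apply: nr_eq0; apply/eqP; rewrite eq_le nr_ge0 andbT leNgt.
by apply/negP => x0; have := h (nr x / 2) ltac:(lra); lra.
Qed.

Lemma nbhs_nr x (A : set V) :
  nbhs x A <-> exists2 e, 0 < e & forall y, nr (x - y) < e -> A y.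
Proof.
split=> [/nbhs_normP[e /= e0 eA]|[e e0 eA]]; last apply/nbhs_normP.
  exists (complex.Re e) => [|y xy]; first by rewrite -ltcR RRe_real// gtr0_real.
  by apply: eA => /=; rewrite -[e]RRe_real ?gtr0_real// nr_lt.
exists (e%:C)%C; first by rewrite /= ltcR.
by move=> y /=; rewrite nr_lt => /eA.
Qed.

Lemma closed_nr F :
  closed F <-> forall x, (forall e, 0 < e -> exists2 y, F y & nr (x - y) < e) -> F x.
Proof.
split=> [cF x h|h x Fx].
  apply: cF => B /nbhs_nr[e e0 eB].
  by have [y Fy /eB By] := h e e0; exists y.
apply: h => e e0; have [|y [Fy yB]] := Fx [set y | nr (x - y) < e].
  by apply/nbhs_nr; exists e.
by exists y.
Qed.

End RealNorm.

Section RealNormScale.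
Variable R : realType.
Implicit Types (U V : normedModType R[i]).

Lemma nrZ V (a : R[i]) (x : V) : nr (a *: x) = nr a * nr x.
Proof. by apply: complexI; rewrite rmorphM /= -!nrE normrZ. Qed.

Lemma nrM (a b : R[i]) : nr (a * b) = nr a * nr b.
Proof. by apply: complexI; rewrite rmorphM /= -!nrE normrM. Qed.

Lemma nr_real (r : R) : nr (r%:C%C : R[i]) = `|r|.
Proof.
have pos (s : R) : 0 <= s -> nr (s%:C%C : R[i]) = s.
  by move=> s0; apply: complexI; rewrite -nrE ger0_norm// lecR.
case: (lerP 0 r) => r0; first by rewrite pos ?ger0_norm.
by rewrite -nrN -rmorphN pos ?ltr0_norm ?oppr_ge0 ?ltW.
Qed.

Lemma nr1 : nr (1 : R[i]) = 1.
Proof. by have := nr_real 1; rewrite normr1. Qed.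

Lemma nrX (a : R[i]) n : nr (a ^+ n) = nr a ^+ n.
Proof. by elim: n => [|n IH]; rewrite ?expr0 ?nr1// !exprS nrM IH. Qed.

Lemma bop_bound U V (T : bop U V) : exists2 K, 0 < K & forall x, nr (T x) <= K * nr x.
Proof.
exists (complex.Re (opnorm T) + 1).
  by rewrite ltr_wpDl// -lecR RRe_real ?opnorm_ge0// ger0_real// opnorm_ge0.
move=> x; have := opnormP T x.
rewrite -[opnorm T]RRe_real ?ger0_real ?opnorm_ge0// !nrE -rmorphM lecR => /le_trans; apply.
by rewrite ler_wpM2r ?nr_ge0// lerDl.
Qed.

Lemma bop_of_bound U V (f : U -> V) (K : R) :
  linear f -> (forall x, nr (f x) <= K * nr x) -> exists T : bop U V, forall x, T x = f x.
Proof.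
move=> lf fK.
have H : f \in @bounded_linear R U V.
  by apply: (@bop_of_bound_subproof _ _ _ _ (K%:C)%C) => // x; rewrite !nrE -rmorphM lecR.
by exists (Bop H).
Qed.

Lemma bop0 U V (T : bop U V) : T 0 = 0. Proof. exact: linear0. Qed.

Lemma bopD U V (T : bop U V) x y : T (x + y) = T x + T y. Proof. exact: linearD. Qed.

Lemma bopN U V (T : bop U V) x : T (- x) = - T x. Proof. exact: linearN. Qed.

Lemma bopB U V (T : bop U V) x y : T (x - y) = T x - T y. Proof. exact: linearB. Qed.

Lemma bopZ U V (T : bop U V) a x : T (a *: x) = a *: T x. Proof. exact: linearZ. Qed.

Lemma bop_ext U V (S T : bop U V) : (forall x, S x = T x) -> S = T.
Proof. by move=> h; apply: val_inj; apply/funext. Qed.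

(* All limits taken below are geometric; this form of completeness also covers
   products and the dual space, which carry no canonical complete structure. *)
Definition geom_complete V := forall (u : nat -> V) (M : R),
  (forall k, nr (u k.+1 - u k) <= M / 2 ^+ k) ->
  exists l, forall k, nr (u k - l) <= 2 * M / 2 ^+ k.

Lemma half_exp_small (M e : R) : 0 < e -> exists k, M / 2 ^+ k < e.
Proof.
move=> e0; exists (Num.truncn `|M / e|).+1.
rewrite ltr_pdivrMr ?exprn_gt0// mulrC -ltr_pdivrMr//.
apply: le_lt_trans (ler_norm _) _; apply: lt_le_trans (truncnS_gt _) _.
by rewrite -natrX ler_nat ltnW// ltn_expl.
Qed.

Lemma geom_sum V (u : nat -> V) M k m : (forall k, nr (u k.+1 - u k) <= M / 2 ^+ k) ->
  nr (u (m + k)%N - u k) <= 2 * M / 2 ^+ k.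
Proof.
(* The exact value of the geometric sum, with its negative term kept, is what passes through the
   induction on [m]. *)
move=> uM; suff : nr (u (m + k)%N - u k) <= 2 * M / 2 ^+ k - 2 * M / 2 ^+ (m + k).
  move=> /le_trans; apply; rewrite gerBl.
  have M0 : 0 <= M by have := le_trans (nr_ge0 _) (uM 0%N); rewrite expr0 divr1.
  by rewrite divr_ge0 ?mulr_ge0 ?exprn_ge0.
elim: m => [|m IH]; first by rewrite add0n !subrr nr0.
apply: le_trans (nr_tri _ (u (m + k)%N) _) _.
apply: le_trans (lerD (uM _) IH) _; rewrite addSn exprS invfM.
by set a := (2 ^+ (m + k))^-1; set b := (2 ^+ k)^-1; lra.
Qed.

(** Closeness to [l] at arbitrarily late indices is enough: the geometric steps carry it back to
    every index with the constant [2 * M]. *)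
Lemma geom_rate V (u : nat -> V) M l :
  (forall k, nr (u k.+1 - u k) <= M / 2 ^+ k) ->
  (forall e k, 0 < e -> exists2 n, (k <= n)%N & nr (u n - l) < e) ->
  forall k, nr (u k - l) <= 2 * M / 2 ^+ k.
Proof.
move=> uM ul k; apply/ler_addgt0Pr => e e0.
have [n kn h] := ul e k e0.
have := geom_sum k (n - k) uM; rewrite subnK// => h2.
have := nr_tri (u k) (u n) l.
by rewrite (nrC (u k) (u n)); lra.
Qed.

Lemma complete_geom_complete (X : completeNormedModType R[i]) : geom_complete X.
Proof.
move=> u M uM.
have cu : cauchy (u @ \oo).
  apply: cauchy_exP => e e0.
  have e1 : 0 < complex.Re e by rewrite -ltcR RRe_real// gtr0_real.
  have [k kM] := half_exp_small (2 * M) e1.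
  exists (u k), k => // n /= kn.
  rewrite -ball_normE /= -[e]RRe_real ?gtr0_real// nr_lt nrC.
  by apply: le_lt_trans kM; rewrite -(subnK kn); exact: geom_sum.
have /cvg_ex[l ul] : cvg (u @ \oo) by exact: cauchy_cvg.
exists l; apply: geom_rate uM _ => e k e0.
have /ul[N _ /(_ (N + k)%N)] : nbhs l [set y | nr (l - y) < e].
  by apply/nbhs_nr; exists e.
by rewrite /= leq_addr => /(_ isT) h; exists (N + k)%N; rewrite ?leq_addl// nrC.
Qed.

End RealNormScale.

(** * Completeness of the scalars, of products and of the dual *)

Section GeomComplete.
Variable R : realType.
Implicit Types (U V : normedModType R[i]).

(** Nested intervals: [b] increases, [c] decreases, and the supremum of [b] lies in every interval
    from [b k] to [c k]. *)
Lemma real_geom_limit (a : nat -> R) M :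
  (forall k, `|a k.+1 - a k| <= M / 2 ^+ k) ->
  exists l, forall k, `|a k - l| <= 2 * M / 2 ^+ k.
Proof.
move=> aM.
pose b k := a k - 2 * M / 2 ^+ k; pose c k := a k + 2 * M / 2 ^+ k.
have M0 : 0 <= M by have := le_trans (normr_ge0 _) (aM 0%N); rewrite expr0 divr1.
have step k : b k <= b k.+1 /\ c k.+1 <= c k.
  have := aM k; rewrite ler_norml /b /c exprS invfM => /andP[].
  by set t := (2 ^+ k)^-1 => h1 h2; split; lra.
have bh : {homo b : m n / (m <= n)%N >-> m <= n}.
  by apply: homo_leq => [//|x y z|k]; [exact: le_trans|case: (step k)].
have ch m n : (m <= n)%N -> c n <= c m.
  elim: n => [|n IH]; rewrite leq_eqVlt => /predU1P[->//|] // /IH.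
  by apply: le_trans; case: (step n).
have bc k : b k <= c k.
  by have : 0 <= 2 * M / 2 ^+ k; [rewrite divr_ge0 ?mulr_ge0 ?exprn_ge0|rewrite /b /c; lra].
have bcs k j : b k <= c j.
  apply: le_trans (bh _ _ (leq_maxl k j)) _; apply: le_trans (bc _) _.
  exact: ch (leq_maxr k j).
exists (sup (range b)) => k.
have : b k <= sup (range b).
  by apply: ub_le_sup; [exists (c 0%N) => _ [j _ <-]|exists k].
have : sup (range b) <= c k.
  by apply: ge_sup; [exists (b 0%N), 0%N|move=> _ [j _ <-]].
by rewrite ler_norml /b /c => h1 h2; apply/andP; split; lra.
Qed.

Lemma nr_i : nr ('i%C : R[i]) = 1.
Proof. by rewrite /nr normc_def /= expr0n expr1n add0r sqrtr1. Qed.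

Lemma normRe_le (z : R[i]) : `|complex.Re z| <= nr z.
Proof.
by rewrite -lecR -nrE; exact: normc_ge_Re.
Qed.

Lemma normIm_le (z : R[i]) : `|complex.Im z| <= nr z.
Proof.
have -> : complex.Im z = complex.Re (- 'i%C * z) by case: z => a b /=; ring.
by apply: le_trans (normRe_le _) _; rewrite nrM nrN nr_i mul1r.
Qed.

Lemma nr_ReIm (z : R[i]) : nr z <= `|complex.Re z| + `|complex.Im z|.
Proof.
rewrite {1}[z]complexE; apply: le_trans (nrD _ _) _.
by rewrite nrM nr_i mul1r !nr_real.
Qed.

Lemma complex_geom_complete : geom_complete (R[i] : normedModType R[i]).
Proof.
move=> u M uM.
have [k|a ua] := @real_geom_limit (fun k => complex.Re (u k)) M.
  by rewrite -raddfB; exact: le_trans (normRe_le _) (uM k).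
have [k|b ub] := @real_geom_limit (fun k => complex.Im (u k)) M.
  by rewrite -raddfB; exact: le_trans (normIm_le _) (uM k).
exists (a +i* b)%C; apply: (geom_rate uM) => e k e0.
(* Adding the errors of both coordinates doubles the constant; [geom_rate] restores [2 * M]. *)
have [n nM] := half_exp_small (4 * M) e0.
exists (n + k)%N; first exact: leq_addl.
apply: le_lt_trans (nr_ReIm _) _; rewrite !raddfB /=.
apply: le_lt_trans (lerD (ua _) (ub _)) _.
apply: le_lt_trans nM; rewrite exprD invfM.
have M0 : 0 <= M by have := le_trans (nr_ge0 _) (uM 0%N); rewrite expr0 divr1.
have : (2 ^+ k)^-1 <= 1 :> R by rewrite invf_le1 ?exprn_gt0// exprn_ege1 ?ler1n.
have : 0 <= (2 ^+ n)^-1 :> R by rewrite invr_ge0 exprn_ge0.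
set s := _^-1; set t := _^-1 => s0 t1.
have : M * s * t <= M * s * 1 by rewrite ler_wpM2l ?mulr_ge0.
by rewrite mulr1 !mulrA -[2 * M * s * t]mulrA; lra.
Qed.

Lemma nr_pair U V (p : (U * V)%type) : nr p = Num.max (nr p.1) (nr p.2).
Proof.
apply/complexI; rewrite -nrE prod_normE !nrE.
by rewrite /Order.max ltcR; case: ifP.
Qed.

Lemma nr_pairP U V (p : (U * V)%type) a : (nr p <= a) = (nr p.1 <= a) && (nr p.2 <= a).
Proof. by rewrite nr_pair ge_max. Qed.

Lemma prod_geom_complete U V : geom_complete U -> geom_complete V ->
  geom_complete (U * V)%type.
Proof.
move=> cU cV u M uM.
have [k|a ua] := cU (fun k => (u k).1) M.
  by have := uM k; rewrite nr_pairP => /andP[].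
have [k|b ub] := cV (fun k => (u k).2) M.
  by have := uM k; rewrite nr_pairP => /andP[].
by exists (a, b) => k; rewrite nr_pairP ua ub.
Qed.

Lemma nr_bop U V (f : bop U V) x : nr (f x) <= nr f * nr x.
Proof. by rewrite -lecR rmorphM /= -!nrE; exact: opnormP. Qed.

Lemma nr_bop_le U V (f : bop U V) K : 0 <= K ->
  (forall x, nr (f x) <= K * nr x) -> nr f <= K.
Proof.
move=> K0 fK; rewrite -nr_le; apply: opnorm_le => x.
rewrite -[1]/(1%:C)%C !nr_le => x1; apply: le_trans (fK x) _.
by rewrite -[leRHS]mulr1 ler_wpM2l.
Qed.

Lemma geom_limit_uniq V (u : nat -> V) C C' l l' :
  (forall k, nr (u k - l) <= C / 2 ^+ k) -> (forall k, nr (u k - l') <= C' / 2 ^+ k) ->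
  l = l'.
Proof.
move=> ul ul'; apply/subr0_eq/nr_small => e e0.
have [k kM] := half_exp_small (C + C') e0.
apply: le_trans (nr_tri _ (u k) _) _; rewrite nrC; apply/ltW/(le_lt_trans _ kM).
by rewrite mulrDl lerD.
Qed.

(** The pointwise limit is linear by uniqueness of limits and bounded by the estimate at index 0;
    the rate is proportional to [nr x], hence convergence holds in operator norm. *)
Lemma dual_geom_complete V : geom_complete (dual V).
Proof.
move=> u M uM.
have M0 : 0 <= M by have := le_trans (nr_ge0 _) (uM 0%N); rewrite expr0 divr1.
have upM x k : nr ((u k.+1 : bop V R[i]) x - (u k : bop V R[i]) x) <= (M * nr x) / 2 ^+ k.
  have := nr_bop (u k.+1 - u k : bop V R[i]) x => /le_trans; apply.
  by rewrite mulrAC ler_wpM2r ?nr_ge0//.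
have /choice[l ul] : forall x, exists l, forall k,
    nr ((u k : bop V R[i]) x - l) <= 2 * (M * nr x) / 2 ^+ k.
  by move=> x; exact: complex_geom_complete (upM x).
have ll : linear l.
  move=> a x y.
  apply: (@geom_limit_uniq _ (fun k => (u k : bop V R[i]) (a *: x + y))
    (2 * (M * nr (a *: x + y))) (nr a * (2 * (M * nr x)) + 2 * (M * nr y))) => // k.
  rewrite linearP opprD addrACA -scalerBr; apply: le_trans (nrD _ _) _.
  by rewrite nrZ mulrDl -[nr a * _ / _]mulrA lerD ?ler_wpM2l ?nr_ge0//; exact: ul.
have [|L LE] := @bop_of_bound _ _ _ l (nr (u 0%N) + 2 * M) ll.
  move=> x; have := ul x 0%N; rewrite expr0 divr1 => h.
  have := nr_bop (u 0%N : bop V R[i]) x => h2.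
  have -> : l x = (u 0%N : bop V R[i]) x - ((u 0%N : bop V R[i]) x - l x).
    by rewrite opprB addrC subrK.
  apply: le_trans (nrD _ _) _; rewrite nrN mulrDl lerD//; lra.
exists L => k; apply: nr_bop_le => [|x].
  by rewrite divr_ge0 ?mulr_ge0 ?exprn_ge0.
by rewrite mulrAC -[2 * M * _]mulrA; have := ul x k; rewrite -LE; exact.
Qed.

End GeomComplete.

(** * Finite extensions of closed subspaces *)

Section Closedness.
Variable R : realType.
Implicit Types (U V : normedModType R[i]).

Lemma dist_closed V (W : set V) v : closed W -> ~ W v ->
  exists2 d, 0 < d & forall w, W w -> d <= nr (v - w).
Proof.
move=> /closed_nr cW nWv; apply: contrapT => h; apply: nWv; apply: cW => e e0.
apply: contrapT => h2; apply: h; exists e => // w Ww; rewrite leNgt; apply/negP => vw.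
by apply: h2; exists w.
Qed.

(** If [v] has distance [d > 0] from [W], the coefficient of [v] in an element of the sum is at most
    its norm divided by [d]. Thus the coefficients of good approximations of [x] converge. *)
Lemma closed_addline V (W : set V) (v : V) : subsp W -> closed W ->
  closed [set x | exists c, W (x - c *: v)].
Proof.
move=> sW cW; have [Wv|nWv] := pselect (W v).
  rewrite (_ : mkset _ = W)//; apply/seteqP; split=> x /=.
    by move=> [c Wc]; apply: subspBK Wc _ => //; exact: subspZ.
  by move=> Wx; exists 0; rewrite scale0r subr0.
have [d d0 dW] := dist_closed cW nWv.
have cd (c : R[i]) w : W w -> nr c * d <= nr (w + c *: v).
  move=> Ww; have [->|c0] := eqVneq c 0; first by rewrite nr0 mul0r nr_ge0.
  have -> : w + c *: v = c *: (v - (- c^-1 *: w)).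
    by rewrite scalerBr scalerA mulrN mulfV// scaleN1r opprK addrC.
  by rewrite nrZ ler_wpM2l ?nr_ge0// dW//; exact: subspZ.
apply/closed_nr => x xh.
have /choice[c cP] k : exists c : R[i], exists2 w, W w & nr (x - (w + c *: v)) < 1 / 2 ^+ k.
  have [|y [c Wc] xy] := xh (1 / 2 ^+ k); first by rewrite divr_gt0 ?exprn_gt0.
  by exists c, (y - c *: v); rewrite ?subrK.
(* Consecutive approximations differ by at most [2 / 2 ^+ k]; dividing by [d] bounds the step
   between coefficients. *)
have [k|a ca] := complex_geom_complete (u := c) (M := 2 / d).
  have [w Ww h] := cP k; have [w' Ww' h'] := cP k.+1.
  have := cd (c k.+1 - c k) (w' - w) (subspB sW Ww' Ww).
  rewrite mulrAC ler_pdivlMr// => /le_trans; apply.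
  have -> : w' - w + (c k.+1 - c k) *: v = (w' + c k.+1 *: v) - (w + c k *: v).
    by rewrite scalerBl opprD addrACA.
  apply: le_trans (nr_tri _ x _) _; rewrite nrC.
  have : 1 / 2 ^+ k.+1 <= 1 / 2 ^+ k :> R.
    by rewrite !div1r lef_pV2 ?posrE ?exprn_gt0// ler_weXn2l ?ler1n.
  by have -> : 2 / 2 ^+ k = 2 * (1 / 2 ^+ k) :> R; [rewrite div1r|lra].
exists a; move/closed_nr : cW; apply=> e e0.
have [k kM] := half_exp_small (1 + 2 * (2 / d) * nr v) e0.
have [w Ww h] := cP k; exists w => //; apply: le_lt_trans kM.
have -> : x - a *: v - w = (x - (w + c k *: v)) + (c k - a) *: v.
  by rewrite scalerBl opprD !addrA subrK addrAC.
apply: le_trans (nrD _ _) _; rewrite mulrDl lerD ?(ltW h)// nrZ mulrAC ler_wpM2r ?nr_ge0//.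
Qed.

(** [U] is [W] plus the lines spanned by the [e i], which are added one at a time. *)
Lemma closed_qfin V (U W : set V) : subsp U -> subsp W -> W `<=` U ->
  closed W -> qfin U W -> closed U.
Proof.
move=> sU sW WU cW [n [e [Ue _ se]]].
have -> : U = [set x | exists c : 'I_n -> R[i], W (x - \sum_i c i *: e i)].
  apply/seteqP; split=> x; first exact: se.
  move=> [c /WU Uc]; apply: subspBK Uc _ => //.
  by apply: subsp_sum => // i; exact: subspZ.
clear U sU WU Ue se; elim: n W sW cW e => [|n IH] W sW cW e.
  rewrite (_ : mkset _ = W)//; apply/seteqP; split=> x /=.
    by move=> [c]; rewrite big_ord0 subr0.
  by move=> Wx; exists (fun=> 0); rewrite big_ord0 subr0.
pose W' := [set x | exists c, W (x - c *: e ord0)].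
have sW' : subsp W'.
  split=> [|a x y [c Wx] [d Wy]]; first by exists 0; rewrite scale0r subr0; exact: subsp0.
  exists (a * c + d); rewrite scalerDl -scalerA opprD addrACA -scalerBr.
  by case: sW => _; apply.
have := IH W' sW' (closed_addline sW cW) (fun i => e (lift ord0 i)).
congr closed; apply/seteqP; split=> x /= [c].
  move=> [d Wd]; exists (fun i => oapp c d (unlift ord0 i)).
  rewrite big_ord_recl unlift_none /= opprD addrA addrAC.
  by under eq_bigr do rewrite liftK.
rewrite big_ord_recl opprD addrA addrAC => Wc.
by exists (fun i => c (lift ord0 i)), (c ord0).
Qed.

Lemma closed_zero V : closed [set (0 : V)].
Proof.
apply/closed_nr => x xh; apply: nr_small => e e0.
by have [_ -> ] := xh e e0; rewrite subr0 => /ltW.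
Qed.

End Closedness.

(** * Open mapping theorem *)

Section OpenMapping.
Variable R : realType.
Variables (U V : normedModType R[i]) (T : bop U V) (D : set U).
Hypotheses (cU : geom_complete U) (sD : subsp D) (cD : closed D).

(** Lifting with relative error 1/2 is iterated on the remainders, which stay in [E]; the
    corrections add up geometrically to an exact lift in the closed subspace [D]. *)
Lemma approx_lift (E : set V) K :
  (forall y, E y -> exists x,
     [/\ D x, nr x <= K * nr y, nr (y - T x) <= nr y / 2 & E (y - T x)]) ->
  forall y, E y -> exists x, [/\ D x, T x = y & nr x <= 2 * K * nr y].
Proof.
move=> h.
have /choice[g gP] y : exists x, E y ->
    [/\ D x, nr x <= K * nr y, nr (y - T x) <= nr y / 2 & E (y - T x)].
  by have [/h[x hx]|nE] := pselect (E y); [exists x|exists 0].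
move=> y Ey.
pose r k := iter k (fun z => z - T (g z)) y.
have rE k : E (r k) by elim: k => [|k IH] //=; case: (gP _ IH).
have rn k : nr (r k) <= nr y / 2 ^+ k.
  elim: k => [|k IH] /=; first by rewrite expr0 divr1.
  have [_ _ h2 _] := gP _ (rE k); apply: le_trans h2 _.
  by rewrite exprS invfM; lra.
pose s k := \sum_(j < k) g (r j).
have sS k : s k.+1 = s k + g (r k) by rewrite /s big_ord_recr.
have sr k : T (s k) = y - r k.
  elim: k => [|k IH]; first by rewrite /s big_ord0 bop0 subrr.
  by rewrite sS bopD IH /= opprB addrA addrAC.
have Ds k : D (s k).
  by apply: subsp_sum => // j; case: (gP _ (rE j)).
have K0 : 0 <= K * nr y by have [_ /(le_trans (nr_ge0 _)) + _ _] := gP _ Ey.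
have [k|x sx] := cU (u := s) (M := K * nr y).
  rewrite sS addrC addKr.
  have [_ h2 _ _] := gP _ (rE k); apply: le_trans h2 _.
  (* The sign of [K] is not given; a negative [K] forces [y] and all remainders to have norm 0. *)
  have [K1|K1] := lerP 0 K; first by rewrite -mulrA ler_wpM2l.
  have y0 : nr y = 0.
    by apply/eqP; rewrite eq_le nr_ge0 andbT -(nmulr_rge0 _ K1).
  have r0 : nr (r k) = 0.
    by apply/eqP; rewrite eq_le nr_ge0 andbT (le_trans (rn k))// y0 mul0r.
  by rewrite y0 r0 !mulr0 mul0r.
have [L L0 TL] := bop_bound T.
exists x; split.
- move/closed_nr : cD; apply=> e e0.
  have [k kM] := half_exp_small (2 * (K * nr y)) e0.
  by exists (s k) => //; rewrite nrC; apply: le_lt_trans kM.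
- apply: (@geom_limit_uniq _ _ (fun k => T (s k)) (L * (2 * (K * nr y))) (nr y)) => k.
    by rewrite -bopB -[_ / _]mulrA; apply: le_trans (TL _) _; rewrite ler_pM2l//; exact: sx.
  by rewrite sr addrC addrA addNr add0r nrN.
- by have := sx 0%N; rewrite /s big_ord0 sub0r nrN expr0 divr1 mulrA.
Qed.

Hypotheses (cV : geom_complete V) (cE : closed (T @` D)).

Let F n : set V := [set y | exists2 x, D x /\ nr x <= n%:R & T x = y].

(** Baire's argument in the image of [D]: if no [F n] is dense in a ball, one chooses shrinking
    balls, each missing the next [F n]. Their common point is some [T x] and lies in [F n] as soon
    as [n] exceeds [nr x]. *)
Lemma baire_ball : exists n y r, [/\ (T @` D) y, 0 < r &
  forall z, (T @` D) z -> nr (z - y) < r ->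
    forall e, 0 < e -> exists2 w, F n w & nr (z - w) < e].
Proof.
pose E := T @` D; apply: contrapT => h.
pose good (p : V * R) := E p.1 /\ 0 < p.2.
have step n (p : V * R) : exists q : V * R, good p ->
  [/\ good q, nr (q.1 - p.1) <= p.2 - q.2, q.2 <= p.2 / 2 &
    forall w, F n w -> q.2 < nr (q.1 - w)].
  have [[Ep p0]|] := pselect (good p); last by exists p.
  apply: contrapT => h1; apply: h; exists n, p.1, (p.2 / 2); split=> //; first by lra.
  move=> z Ez zp e e0; apply: contrapT => h2; apply: h1.
  (* Halving the old radius keeps the new ball inside the old one; [e / 2] keeps it away from [F n],
     whose points are at distance at least [e] from [z]. *)
  exists (z, Num.min (p.2 / 2) (e / 2)) => _ /=; split=> //=.
  - by split=> //=; rewrite lt_min; apply/andP; split; lra.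
  - have : Num.min (p.2 / 2) (e / 2) <= p.2 / 2 by rewrite ge_min lexx.
    by lra.
  - by rewrite ge_min lexx.
  - move=> w Fw; rewrite gt_min; apply/orP; right.
    have : e <= nr (z - w) by rewrite leNgt; apply/negP => zw; apply: h2; exists w.
    by lra.
have /choice[f fP] := fun np : nat * (V * R) => step np.1 np.2.
pose p k := iteri k (fun n q => f (n, q)) (0, 1).
have pg k : good (p k).
  elim: k => [|k IH] /=; last by case: (fP (k, _) IH).
  by split=> //=; exists 0; rewrite ?bop0//; exact: subsp0.
have pr k : (p k).2 <= 1 / 2 ^+ k.
  elim: k => [|k IH] /=; first by rewrite expr0 divr1.
  have [_ _ + _] := fP (k, _) (pg k); rewrite -/(p k) exprS invfM => h2.
  by apply: le_trans h2 _; lra.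
have [k|l pl] := cV (u := fun k => (p k).1) (M := 1).
  have [_ + _ _] := fP (k, _) (pg k); rewrite -/(p k) => /le_trans; apply.
  have [_ /ltW] := pg k.+1; rewrite /= -/(p k) => ?.
  by apply: le_trans (pr k); rewrite gerBl.
have dist k m : nr ((p (m + k)%N).1 - (p k).1) <= (p k).2 - (p (m + k)%N).2.
  elim: m => [|m IH]; first by rewrite add0n !subrr nr0.
  apply: le_trans (nr_tri _ (p (m + k)%N).1 _) _.
  have [_ + _ _] := fP ((m + k)%N, _) (pg (m + k)%N).
  by rewrite addSn /= -/(p _); lra.
have lp k : nr (l - (p k).1) <= (p k).2.
  apply/ler_addgt0Pr => e e0; have [m mM] := half_exp_small (2 * 1) e0.
  apply: le_trans (nr_tri _ (p (m + k)%N).1 _) _.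
  have [_ /ltW m0] := pg (m + k)%N.
  have := dist k m; rewrite (nrC l).
  suff : nr ((p (m + k)%N).1 - l) <= e by lra.
  apply: le_trans (pl _) _; apply: le_trans (ltW mM).
  rewrite ler_wpM2l ?mulr_ge0// lef_pV2 ?posrE ?exprn_gt0//.
  by rewrite ler_weXn2l ?ler1n// leq_addr.
have [x Dx xl] : E l.
  move/closed_nr : cE; apply=> e e0; have [k kM] := half_exp_small (2 * 1) e0.
  exists (p k).1; first by case: (pg k).
  by rewrite nrC; exact: le_lt_trans (pl k) kM.
(* The ball that misses [F n] is the one with index [n.+1]. *)
pose n := (Num.truncn (nr x)).+1.
have [_ _ _ /(_ l)] := fP (n, _) (pg n).
have Fl : F n l by exists x => //; split=> //; rewrite ltW// truncnS_gt.
by move=> /(_ Fl); have := lp n.+1; rewrite /= -/(p n) nrC leNgt => /negP.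
Qed.

(** Stated relative to a closed subspace with closed image. Density near [y0] is moved to 0 by
    subtraction, made homogeneous by scaling, and turned into exact lifts by [approx_lift]. *)
Theorem open_mapping : exists2 K, 0 < K & forall y, (T @` D) y ->
  exists x, [/\ D x, T x = y & nr x <= K * nr y].
Proof.
have [n [y0 [r [Ey0 r0 yr]]]] := baire_ball.
have sE := subsp_image (bop_linear T) sD.
have small y e : (T @` D) y -> nr y < r -> 0 < e ->
    exists x, [/\ D x, nr x <= 2 * n%:R & nr (y - T x) <= e].
  move=> Ey yr' e0.
  have [|||_ [a [Da an] <-] ya] := yr (y + y0) _ _ (e / 2);
    [exact: subspD|by rewrite addrK|by lra|].
  have [||_ [b [Db bn] <-] yb] := yr y0 Ey0 _ (e / 2); [by rewrite subrr nr0|by lra|].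
  exists (a - b); split; first exact: subspB.
    by apply: le_trans (nrD _ _) _; rewrite nrN; lra.
  have -> : y - T (a - b) = (y + y0 - T a) - (y0 - T b).
    by rewrite bopB !opprB (addrAC y) addrACA subrr addr0 -addrA (addrC (- _)).
  by apply: le_trans (nrD _ _) _; rewrite nrN; lra.
pose K := 4 * n%:R / r + 1.
have K0 : 0 < K by rewrite ltr_wpDl// divr_ge0 ?mulr_ge0// ltW.
exists (2 * K); first by lra.
apply: approx_lift => y Ey.
have [->|/nr_gt0 ny] := eqVneq y 0.
  exists 0; rewrite bop0 subr0 !nr0; split; rewrite ?mulr0 ?mul0r//.
    exact: subsp0.
  exact: subsp0.
(* [t] scales [y] to norm [r / 2]; scaling back turns the error [r / 4] into [nr y / 2] and the
   bound [2 * n] into [4 * n / r * nr y], the origin of [K]. *)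
pose t := r / (2 * nr y).
have t0 : 0 < t by rewrite divr_gt0 ?mulr_gt0.
have [||x [Dx xn yx]] := small (t%:C%C *: y) (r / 4) (subspZ _ sE Ey); last 1 first.
- pose x' := (t^-1)%:C%C *: x.
  have tx : y - T x' = (t^-1)%:C%C *: (t%:C%C *: y - T x).
    by rewrite scalerBr scalerA -rmorphM /= mulVf ?gt_eqF// scale1r bopZ.
  exists x'; split.
  + exact: subspZ.
  + rewrite nrZ nr_real gtr0_norm ?invr_gt0//.
    apply: (@le_trans _ _ (t^-1 * (2 * n%:R))); first by rewrite ler_pM2l ?invr_gt0.
    have -> : t^-1 * (2 * n%:R) = (4 * n%:R / r) * nr y.
      by rewrite /t invfM invrK; field; rewrite gt_eqF.
    by rewrite ler_pM2r// /K lerDl.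
  + rewrite tx nrZ nr_real gtr0_norm ?invr_gt0//.
    apply: (@le_trans _ _ (t^-1 * (r / 4))); first by rewrite ler_pM2l ?invr_gt0.
    by rewrite /t invfM invrK le_eqVlt; apply/orP; left; apply/eqP; field; rewrite gt_eqF.
  + by apply: subspB => //; exists x' => //; exact: subspZ.
- rewrite nrZ nr_real gtr0_norm// /t.
  have -> : r / (2 * nr y) * nr y = r / 2 by field; rewrite gt_eqF.
  by lra.
- by lra.
Qed.

End OpenMapping.

(** * Hahn-Banach theorem *)

Section Sublinear.
Variables (R : realType) (V : lmodType R[i]).
Implicit Types (p q : V -> R) (G : set (V * R)).

Definition sublinear q := [/\ q 0 = 0, forall x y, q (x + y) <= q x + q y &
  forall r x, 0 < r -> q (r%:C%C *: x) <= r * q x].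

Lemma sublinearZ q r x : sublinear q -> 0 <= r -> q (r%:C%C *: x) = r * q x.
Proof.
move=> [q0 _ qZ]; rewrite le_eqVlt => /predU1P[<-|r0].
  by rewrite scale0r q0 mul0r.
apply/eqP; rewrite eq_le qZ//= -ler_pdivlMl//.
have := qZ r^-1 (r%:C%C *: x); rewrite scalerA -rmorphM /= mulVf ?gt_eqF// scale1r.
by apply; rewrite invr_gt0.
Qed.

Lemma sublinear_ge q x : sublinear q -> - q (- x) <= q x.
Proof. by move=> [q0 qD _]; have := qD x (- x); rewrite subrr q0; lra. Qed.

(* G is (the graph over a convex cone of) a functional dominated by p. *)
Definition below p G : V -> R := fun x => inf [set p (x + u.1) - u.2 | u in G].

Section Below.
Variables (p : V -> R) (G : set (V * R)).
Hypotheses (sp : sublinear p) (G0 : G (0, 0))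
  (GD : forall u v, G u -> G v -> G (u.1 + v.1, u.2 + v.2))
  (GZ : forall r u, 0 < r -> G u -> G (r%:C%C *: u.1, r * u.2))
  (Gp : forall u, G u -> u.2 <= p u.1).

Let lb x : lbound [set p (x + u.1) - u.2 | u in G] (- p (- x)).
Proof.
move=> _ [u Gu <-]; case: sp => _ pD _.
have := pD (x + u.1) (- x); rewrite addrC addKr.
by have := Gp Gu; lra.
Qed.

Lemma below_le x u : G u -> below p G x <= p (x + u.1) - u.2.
Proof. by move=> Gu; apply: ge_inf; [exists (- p (- x)); exact: lb|exists u]. Qed.

Let le_below x c : (forall u, G u -> c <= p (x + u.1) - u.2) -> c <= below p G x.
Proof.
by move=> h; apply: lb_le_inf => [|_ [u Gu <-]]; [exists (p (x + 0) - 0), (0, 0)|exact: h].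
Qed.

Lemma sublinear_below : sublinear (below p G).
Proof.
have [p0 pD pZ] := sp; split=> [|x y|r x r0].
- apply/le_anti/andP; split.
    by have := below_le 0 G0; rewrite /= addr0 p0 subr0.
  by apply: le_below => u /Gp; rewrite add0r; lra.
- rewrite -lerBlDr; apply: le_below => u Gu.
  rewrite lerBlDr -lerBlDl; apply: le_below => v Gv.
  have := below_le (x + y) (GD Gu Gv); have := pD (x + u.1) (y + v.1).
  by rewrite /= addrACA; lra.
- rewrite -ler_pdivrMl//; apply: le_below => u Gu.
  rewrite ler_pdivrMl//; apply: le_trans (below_le _ (GZ r0 Gu)) _ => /=.
  by rewrite -scalerDr mulrBr lerD2r; exact: pZ.
Qed.

End Below.

(* Comparing q with x |-> inf_(t >= 0) (q (x + t y) - t q y) shows that minimal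
   sublinear functionals are linear; Zorn's lemma then yields Hahn-Banach without
   partially defined functionals. *)
Lemma minimal_sublinear_additive q :
  sublinear q -> (forall q', sublinear q' -> (forall x, q' x <= q x) -> q' = q) ->
  forall x y, q (x + y) = q x + q y.
Proof.
move=> sq qmin x y; have [q0 qD qZ] := sq.
apply/le_anti/andP; split; first exact: qD.
pose G := [set u : V * R | exists2 t : R, 0 <= t & u = (t%:C%C *: y, t * q y)].
have GP : [/\ G (0, 0), forall u v, G u -> G v -> G (u.1 + v.1, u.2 + v.2),
    forall r u, 0 < r -> G u -> G (r%:C%C *: u.1, r * u.2) &
    forall u, G u -> u.2 <= q u.1].
  split=> [|_ _ [t t0 ->] [s s0 ->] /=|r _ r0 [t t0 ->] /=|_ [t t0 ->] /=].
  - by exists 0 => //; rewrite scale0r mul0r.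
  - by exists (t + s); rewrite ?addr_ge0// rmorphD /= scalerDl mulrDl.
  - by exists (r * t); rewrite ?mulr_ge0 ?(ltW r0)// rmorphM /= scalerA mulrA.
  - by rewrite sublinearZ.
have [G0 GD GZ Gq] := GP.
have qE : below q G = q.
  apply: qmin => [|z]; first exact: sublinear_below.
  by have := below_le sq Gq z G0; rewrite /= addr0 subr0.
have Gy : G (y, q y) by exists 1 => //; rewrite scale1r mul1r.
by have := below_le sq Gq x Gy; rewrite qE /=; lra.
Qed.

(** Zorn's lemma for the reversed pointwise order. A nonempty chain is bounded by its pointwise
    infimum, finite because [- p (- x)] lies below all members; the empty chain is bounded by
    [p]. *)
Lemma exists_minimal_sublinear p : sublinear p ->
  exists q, [/\ sublinear q, forall x, q x <= p x &
    forall q', sublinear q' -> (forall x, q' x <= q x) -> q' = q].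
Proof.
move=> sp; pose T := {q : V -> R | sublinear q /\ forall x, q x <= p x}.
pose le (s t : T) := `[< forall x, sval t x <= sval s x >].
have [||s t /asboolP st /asboolP ts|A totA|m mmin] := @Zorn T le.
- by move=> t; apply/asboolP.
- move=> r s t /asboolP rs /asboolP st; apply/asboolP => x.
  exact: le_trans (st x) (rs x).
- case: s t st ts => [s ps] [t pt] /= st ts.
  have e : s = t by apply/funext => x; apply/le_anti; rewrite st ts.
  by subst t; congr exist; exact: Prop_irrelevance.
- have [[t0 At0]|nA] := pselect (exists t, A t); last first.
    by exists (exist _ p (conj sp (fun x => lexx _)) : T) => s As; case: nA; exists s.
  pose E x := [set sval t x | t in A].
  have lbE x : lbound (E x) (- p (- x)).
    move=> _ [[q [sq qp]] _ <-] /=; apply: le_trans (sublinear_ge _ sq).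
    by rewrite lerN2.
  have iE x t : A t -> inf (E x) <= sval t x.
    by move=> At; apply: ge_inf; [exists (- p (- x)); exact: lbE|exists t].
  have leE x c : (forall t, A t -> c <= sval t x) -> c <= inf (E x).
    by move=> h; apply: lb_le_inf => [|_ [t At <-]]; [exists (sval t0 x), t0|exact: h].
  have sq : sublinear (fun x => inf (E x)).
    split=> [|x y|r x r0].
    + apply/le_anti/andP; split.
        by have := iE 0 _ At0; case: (t0) => [q [[q0 _ _] _]] /=; rewrite q0.
      by apply/leE => -[q [[q0 _ _] _]] /= _; rewrite q0.
    + rewrite -lerBlDr; apply/leE => s As.
      rewrite lerBlDr -lerBlDl; apply/leE => t At; rewrite lerBlDr.
      (* The smaller of two members of the chain can be used for both infima. *)
      have [/asboolP st|/asboolP ts] := totA s t As At.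
        apply: le_trans (iE _ _ At) _; have := st x.
        by case: (t) => [q [[_ qD _] _]] /= ?; have := qD x y; lra.
      apply: le_trans (iE _ _ As) _; have := ts y.
      by case: (s) => [q [[_ qD _] _]] /= ?; have := qD x y; lra.
    + rewrite -ler_pdivrMl//; apply/leE => t At; rewrite ler_pdivrMl//.
      apply: le_trans (iE _ _ At) _.
      by case: (t) => [q [[_ _ qZ] _]] /=; exact: qZ.
  have qp x : inf (E x) <= p x.
    by apply: le_trans (iE _ _ At0) _; case: (t0) => [q []].
  exists (exist _ (fun x => inf (E x)) (conj sq qp) : T) => s As; apply/asboolP => x /=; exact: iE.
case: m mmin => [q [sq qp]] qmin; exists q; split=> // q' sq' q'q.
have q'p x : q' x <= p x by exact: le_trans (q'q x) (qp x).
by have := qmin (exist _ q' (conj sq' q'p) : T); move=> h; have [] := h (introT (asboolP _) q'q).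
Qed.

(** [L] is minimal under [below p G]. Evaluating this domination at [- u.1] gives [u.2 <= L u.1] on
    [G]; the same for the opposite pair gives equality. *)
Lemma real_hahn_banach p G : sublinear p -> G (0, 0) ->
  (forall u v, G u -> G v -> G (u.1 + v.1, u.2 + v.2)) ->
  (forall (r : R) u, G u -> G (r%:C%C *: u.1, r * u.2)) ->
  (forall u, G u -> u.2 <= p u.1) ->
  exists L : V -> R, [/\ forall x y, L (x + y) = L x + L y,
    forall r x, L (r%:C%C *: x) = r * L x, forall x, L x <= p x &
    forall u, G u -> L u.1 = u.2].
Proof.
move=> sp G0 GD GZ Gp; have GZ' r u (_ : 0 < r) : G u -> _ := GZ r u.
have [L [sL Lle Lmin]] := exists_minimal_sublinear (sublinear_below sp G0 GD GZ' Gp).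
have LD := minimal_sublinear_additive sL Lmin.
have L0 : L 0 = 0 by case: sL.
have LN x : L (- x) = - L x by have := LD x (- x); rewrite subrr L0; lra.
have LG u : G u -> u.2 <= L u.1.
  move=> Gu; have := Lle (- u.1); have := below_le sp Gp (- u.1) Gu.
  by rewrite addNr LN; case: sp => -> _ _; lra.
exists L; split=> [//|r x|x|u Gu].
- have [r0|r0] := lerP 0 r; first exact: sublinearZ.
  rewrite -[in LHS](opprK r) rmorphN /= scaleNr LN sublinearZ ?oppr_ge0 ?ltW//.
  by rewrite mulNr opprK.
- apply: le_trans (Lle x) _; have := below_le sp Gp x G0.
  by rewrite /= addr0 subr0.
- have := LG _ (GZ (-1) u Gu); have := LG _ Gu.
  by rewrite /= rmorphN scaleN1r LN mulN1r; lra.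
Qed.

End Sublinear.

Section HahnBanach.
Variables (R : realType) (V : normedModType R[i]).

(** The real part of [g] is extended to a real functional [L], and [L x - i L (i x)] is the
    complex-linear functional with real part [L]. *)
Theorem hahn_banach (F : set V) (g : V -> R[i]) (K : R) : subsp F -> 0 <= K ->
  (forall a x y, F x -> F y -> g (a *: x + y) = a * g x + g y) ->
  (forall x, F x -> nr (g x) <= K * nr x) ->
  exists phi : dual V, forall x, F x -> (phi : bop V R[i]) x = g x.
Proof.
move=> sF K0 gl gK.
have gZ a x : F x -> g (a *: x) = a * g x.
  move=> Fx; have g00 := gl 1 0 0 (subsp0 sF) (subsp0 sF).
  have g0 : g 0 = 0.
    by move: g00; rewrite scale1r addr0 mul1r => /esym/(canRL (addrK _)); rewrite subrr.
  by have := gl a x 0 Fx (subsp0 sF); rewrite !addr0 g0 addr0.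
pose G := [set u : V * R | F u.1 /\ u.2 = complex.Re (g u.1)].
have [|||||L [LD LZ LK LG]] := @real_hahn_banach R V (fun x => K * nr x) G.
- split=> [|x y|r x r0]; first by rewrite nr0 mulr0.
    by rewrite -mulrDr ler_wpM2l// nrD.
  by rewrite nrZ nr_real gtr0_norm// mulrCA.
- split; first exact: subsp0.
  by rewrite -[X in g X](scale0r 0) gZ ?mul0r//; exact: subsp0.
- move=> u v [Fu uE] [Fv vE]; split=> /=; first exact: subspD.
  by rewrite uE vE -[u.1]scale1r gl// mul1r raddfD scale1r.
- move=> r u [Fu uE]; split=> /=; first exact: subspZ.
  by rewrite uE gZ//; case: (g u.1) => a b /=; ring.
- move=> u [Fu ->]; apply: le_trans (ler_norm _) _.
  by apply: le_trans (normRe_le _) _; exact: gK.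
have LRe x : F x -> L x = complex.Re (g x) by move=> Fx; apply: (LG (x, _)).
have LN x : L (- x) = - L x.
  by have := LZ (-1) x; rewrite rmorphN scaleN1r mulN1r.
pose phi x : R[i] := (L x +i* - L ('i%C *: x))%C.
have phiD x y : phi (x + y) = phi x + phi y.
  by rewrite /phi scalerDr !LD opprD.
have phiR r x : phi (r%:C%C *: x) = r%:C%C * phi x.
  have ir : 'i%C *: (r%:C%C *: x) = r%:C%C *: ('i%C *: x) by rewrite !scalerA mulrC.
  rewrite /phi ir !LZ.
  by apply/eqP; rewrite eq_complex /=; apply/andP; split; apply/eqP; ring.
have phiI x : phi ('i%C *: x) = 'i%C * phi x.
  rewrite /phi scalerA -expr2 sqr_i scaleN1r LN.
  by apply/eqP; rewrite eq_complex /=; apply/andP; split; apply/eqP; ring.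
have phiZ a x : phi (a *: x) = a * phi x.
  by rewrite {1}[a]complexE scalerDl -scalerA phiD phiR phiI phiR mulrA -mulrDl -complexE.
have phil : linear (phi : V -> R[i]) by move=> a x y; rewrite phiD phiZ.
have phiK x : nr (phi x) <= K * nr x.
  have [->|z0] := eqVneq (phi x) 0; first by rewrite nr0 mulr_ge0 ?nr_ge0.
  have n0 := nr_gt0 z0.
  (* A unimodular factor rotates [phi x] onto the positive real axis, where [phi] agrees with
     [L]. *)
  pose t : R[i] := (nr (phi x))%:C%C / phi x.
  have t1 : nr t = 1.
    apply: (mulIf (lt0r_neq0 n0)).
    by rewrite -nrM /t divfK// mul1r nr_real gtr0_norm.
  have := LK (t *: x); rewrite nrZ t1 mul1r; apply: le_trans.
  have : phi (t *: x) = (nr (phi x))%:C%C by rewrite phiZ /t divfK.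
  by move/(congr1 (@complex.Re R)) => /= ->.
have [f fE] := bop_of_bound phil phiK.
exists f => x Fx; rewrite fE /phi !LRe//; last exact: subspZ.
by rewrite gZ//; case: (g x) => a b /=; congr (_ +i* _)%C; ring.
Qed.

(** The coefficient of [v] on [W] plus the line of [v] is well defined and bounded by the inverse of
    the distance from [v] to [W]; it is then extended. *)
Lemma hahn_banach_sep (W : set V) (v : V) : subsp W -> closed W -> ~ W v ->
  exists phi : dual V, (forall w, W w -> (phi : bop V R[i]) w = 0) /\
    (phi : bop V R[i]) v = 1.
Proof.
move=> sW cW nWv.
pose F := [set x | exists c : R[i], W (x - c *: v)].
have uniq x c c' : W (x - c *: v) -> W (x - c' *: v) -> c = c'.
  move=> Wc Wc'; apply/eqP/negPn/negP => cc'; apply: nWv.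
  have := subspB sW Wc' Wc.
  rewrite opprB addrC addrA subrK -scalerBl.
  by move/(subspZ (c - c')^-1 sW); rewrite scalerA mulVf ?subr_eq0// scale1r.
have /choice[g gP] x : exists c : R[i], F x -> W (x - c *: v).
  by have [[c Wc]|nF] := pselect (F x); [exists c|exists 0].
have gE x c : W (x - c *: v) -> g x = c.
  by move=> Wc; exact: uniq (gP _ (ex_intro _ c Wc)) Wc.
have sF : subsp F.
  split=> [|a x y [c Wc] [d Wd]]; first by exists 0; rewrite scale0r subr0; exact: subsp0.
  exists (a * c + d); rewrite scalerDl -scalerA opprD addrACA -scalerBr.
  by case: sW => _; apply.
have [d d0 dW] := dist_closed cW nWv.
have [||x Fx|phi phiE] := @hahn_banach F g d^-1 sF.
- by rewrite invr_ge0 ltW.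
- move=> a x y /gP Wx /gP Wy; apply: gE.
  rewrite scalerDl -scalerA opprD addrACA -scalerBr.
  by case: sW => _; apply.
- rewrite ler_pdivlMl// mulrC.
  have [->|c0] := eqVneq (g x) 0; first by rewrite nr0 mul0r nr_ge0.
  have {2}-> : x = g x *: (v - - (g x)^-1 *: (x - g x *: v)).
    by rewrite scaleNr opprK scalerDr scalerA mulfV// scale1r addrC subrK.
  by rewrite nrZ ler_wpM2l ?nr_ge0// dW//; apply: subspZ => //; exact: gP.
exists phi; split=> [w Ww|].
  by rewrite phiE ?(gE w 0)//; [|exists 0]; rewrite scale0r subr0.
by rewrite phiE ?(gE v 1)//; [|exists 1]; rewrite scale1r subrr; exact: subsp0.
Qed.

End HahnBanach.

(** * Operators with closed range *)

Section Operators.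
Variables (R : realType) (Y : normedModType R[i]).
Implicit Types (S T : bop Y Y) (W : set Y).

Lemma subsp_ker T : subsp (ker T).
Proof.
split=> [|a x y Tx Ty]; first exact: bop0.
by rewrite /ker /= bopD bopZ Tx Ty scaler0 addr0.
Qed.

Lemma subsp_range T : subsp (range T).
Proof. by apply: (subsp_image (bop_linear T)); exact: subspT. Qed.

Lemma has_dimE W n : has_dim W n <-> qdim W [set 0] n.
Proof.
split=> -[e [We ie se]]; exists e; split=> // v /se[c].
  by move=> ->; exists c; rewrite /= subrr.
by move=> /subr0_eq ?; exists c.
Qed.

Lemma has_codimE W n : has_codim W n <-> qdim setT W n.
Proof.
split=> [[e [ie se]]|[e [_ ie se]]]; exists e; first by split.
by split=> // v; exact: se.
Qed.

Lemma dimE W n : subsp W -> qdim W [set 0] n -> Defs.dim W = n.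
Proof.
move=> sW Wn; apply: (qdim_uniq (@subsp_zero _ Y) _ Wn).
by apply/has_dimE; rewrite /Defs.dim; case: xgetP => [m _ //|/(_ n)[]]; apply/has_dimE.
Qed.

Lemma codimE W n : subsp W -> qdim setT W n -> codim W = n.
Proof.
move=> sW Wn; apply: (qdim_uniq sW _ Wn).
by apply/has_codimE; rewrite /codim; case: xgetP => [m _ //|/(_ n)[]]; apply/has_codimE.
Qed.

Lemma finite_dimE W : finite_dim W <-> qfin W [set 0].
Proof. by split=> -[n /has_dimE ?]; exists n. Qed.

Lemma finite_codimE W : finite_codim W <-> qfin setT W.
Proof. by split=> -[n /has_codimE ?]; exists n. Qed.

Hypothesis cY : geom_complete Y.

Lemma closed_finite_dim W : subsp W -> qfin W [set 0] -> closed W.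
Proof.
move=> sW; apply: closed_qfin => //; [exact: subsp_zero| |exact: closed_zero].
by move=> _ ->; exact: subsp0.
Qed.

Lemma closed_setT : closed [set: Y]. Proof. exact: closedT. Qed.

Lemma closed_sumsp W F : subsp W -> subsp F -> closed W -> qfin F [set 0] ->
  closed (sumsp W F).
Proof.
move=> sW sF cW fF; apply: (closed_qfin (W := W)) => //.
- exact: subsp_sumsp.
- exact: sumspl.
- exact: qfin_sumsp.
Qed.

Lemma lift_range T : closed (range T) -> exists2 K, 0 < K &
  forall y, range T y -> exists2 x, T x = y & nr x <= K * nr y.
Proof.
move=> cT; have [K K0 h] := open_mapping cY (@subspT _ Y) closed_setT cY cT.
by exists K => // y /h[x [_ ? ?]]; exists x.
Qed.

(** For a limit point [y = T u] of the image, bounded lifts of [y - T w] show that [u] is a limit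
    point of [W + ker T], which is closed because the kernel is finite-dimensional. *)
Lemma closed_image T W : closed (range T) -> qfin (ker T) [set 0] ->
  subsp W -> closed W -> closed (T @` W).
Proof.
move=> cT fT sW cW; have [K K0 lift] := lift_range cT.
apply/closed_nr => y yh.
have [u _ uy] : range T y.
  move/closed_nr : cT; apply=> e /yh[_ [w Ww <-] h].
  by exists (T w) => //; exists w.
have sk := subsp_ker T.
have : sumsp W (ker T) u.
  move/closed_nr : (closed_sumsp sW sk cW fT); apply=> e e0.
  have [|_ [w Ww <-] yw] := yh (e / K); first by rewrite divr_gt0.
  have [|d dE dn] := lift (y - T w).
    by rewrite -uy -bopB; exists (u - w).
  exists (u - d).
    exists w => //; rewrite /ker /= !bopB dE uy.
    by rewrite subKr subrr.
  rewrite opprB addrC subrK; apply: le_lt_trans dn _.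
  by rewrite mulrC -ltr_pdivlMr.
move=> [w Ww]; rewrite /ker /= bopB => /subr0_eq wE.
by exists w => //; rewrite -uy.
Qed.

(** With [E] a finite-dimensional complement of the range, [(x, e) |-> T x + e] maps onto the whole
    space and has bounded lifts. A limit point of the range therefore has an arbitrarily small,
    hence zero, component in [E]. *)
Lemma closed_range_cofinite T : qfin setT (range T) -> closed (range T).
Proof.
move=> [n [e [_ ie se]]].
have [K K0 TK] := bop_bound T.
pose E := [set x | exists c : 'I_n -> R[i], x = \sum_i c i *: e i].
have sE : subsp E.
  split=> [|a _ _ [c ->] [d ->]].
    by exists (fun=> 0); rewrite big1// => i _; rewrite scale0r.
  exists (fun i => a * c i + d i); rewrite scaler_sumr -big_split /=.
  by apply: eq_bigr => i _; rewrite scalerDl scalerA.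
have iE0 c : \sum_i c i *: e i = 0 -> forall i, c i = 0.
  by move=> c0; apply: ie; rewrite c0; exact: subsp0 (subsp_range T).
have fE : qfin E [set 0].
  exists n, e; split=> // [i|v [c ->]].
    exists (fun j => (j == i)%:R); rewrite (bigD1 i)//= eqxx scale1r big1 ?addr0//.
    by move=> j /negPf ->; rewrite scale0r.
  by exists c; rewrite /= subrr.
have cE := closed_finite_dim sE fE.
pose f (p : (Y * Y)%type) := T p.1 + p.2.
have fl : linear f.
  by move=> a p q; rewrite /f /= bopD bopZ scalerDr addrACA.
have [p|f' f'E] := bop_of_bound (K := K + 1) fl.
  have : nr p <= nr p by []; rewrite nr_pairP => /andP[p1 p2].
  apply: le_trans (nrD _ _) _; rewrite mulrDl mul1r lerD//.
  by apply: le_trans (TK _) _; rewrite ler_pM2l.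
pose D := [set p : (Y * Y)%type | E p.2].
have sD : subsp D by split=> [|a p q]; [exact: subsp0 sE|case: sE => _; apply].
have cD : closed D.
  apply/closed_nr => p ph; move/closed_nr : cE; apply=> t t0.
  have [q Dq pq] := ph t t0; exists q.2 => //; apply: le_lt_trans pq.
  by have : nr (p - q) <= nr (p - q) by []; rewrite nr_pairP => /andP[].
have fD : f' @` D = setT.
  apply/seteqP; split=> // y _; have [c [x _ xy]] := se y I.
  exists (x, \sum_i c i *: e i); first by exists c.
  by rewrite f'E /f /= xy subrK.
have [|L L0 lift] := open_mapping (T := f') (prod_geom_complete cY cY) sD cD cY.
  by rewrite fD; exact: closedT.
apply/closed_nr => y yh.
have [c [x _ xy]] := se y I.
set z := \sum_i _ in xy.
suff z0 : z = 0 by exists x => //; rewrite xy z0 subr0.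
apply: nr_small => t t0.
have [|_ [u _ <-] yu] := yh (t / L); first by rewrite divr_gt0.
have [|p [Dp pE pn]] := lift (y - T u); first by rewrite fD.
have pE' : T p.1 + p.2 = y - T u by rewrite -pE f'E.
clear pE; move: pE' => pE; case: Dp => d p2; move: pn; rewrite nr_pairP => /andP[_ pn].
(* [y] and [y - T u] agree modulo the range, so independence identifies their components in [E]. *)
have : range T (\sum_i (c i - d i) *: e i).
  exists (u + p.1 - x) => //.
  under eq_bigr do rewrite scalerBl.
  rewrite sumrB -/z -p2 bopB bopD xy.
  have -> : T u + T p.1 = y - p.2.
    by apply/eqP; rewrite eq_sym subr_eq -addrA pE addrC subrK.
  by rewrite opprB addrC addrA subrK.
move/ie => cd; have zp : z = p.2.
  by rewrite p2; apply: eq_bigr => i _; rewrite (subr0_eq (cd i)).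
by rewrite zp; apply: le_trans pn _; rewrite mulrC -ler_pdivlMr// ltW.
Qed.

Lemma invertibleP T : invertible T <-> ker T = [set 0] /\ range T = setT.
Proof.
split=> [[S [ST TS]]|[kT rT]].
  have STx x : S (T x) = x by have := congr1 (fun f : bop Y Y => f x) ST.
  have TSx x : T (S x) = x by have := congr1 (fun f : bop Y Y => f x) TS.
  split; apply/seteqP; split=> // x /=.
  - by rewrite /ker /= => Tx; rewrite -(STx x) Tx bop0.
  - by move=> ->; exact: bop0.
  - by exists (S x).
have [K K0 lift] : exists2 K, 0 < K &
    forall y, range T y -> exists2 x, T x = y & nr x <= K * nr y.
  by apply: lift_range; rewrite rT; exact: closedT.
have /choice[s sP] y : exists x, T x = y /\ nr x <= K * nr y.
  by have [|x] := lift y; [rewrite rT|exists x].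
have Tinj x y : T x = T y -> x = y.
  move=> xy; apply/subr0_eq; have : ker T (x - y) by rewrite /ker /= bopB xy subrr.
  by rewrite kT.
have [||S SE] := @bop_of_bound _ _ _ s K.
- by move=> a x y; apply: Tinj; rewrite bopD bopZ !(sP _).1.
- by move=> x; case: (sP x).
exists S; split; apply: bop_ext => x /=.
  by apply: Tinj; rewrite SE (sP _).1.
by rewrite SE (sP _).1.
Qed.

Lemma bop_expSr T n x : bop_exp T n.+1 x = bop_exp T n (T x).
Proof. by elim: n => [|n IH] //=; rewrite -IH. Qed.

Lemma bop_expD T m n x : bop_exp T (m + n) x = bop_exp T m (bop_exp T n x).
Proof. by elim: m => [|m IH] //=; rewrite IH. Qed.

Lemma range_expS T n : range (bop_exp T n.+1) = T @` range (bop_exp T n).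
Proof.
apply/seteqP; split=> [_ [x _ <-]|_ [_ [x _ <-] <-]]; last by exists x.
by exists (bop_exp T n x) => //; exists x.
Qed.

Lemma range_exp_le T m n : (m <= n)%N -> range (bop_exp T n) `<=` range (bop_exp T m).
Proof.
move=> mn _ [x _ <-]; exists (bop_exp T (n - m) x) => //.
by rewrite -bop_expD subnKC.
Qed.

End Operators.

(** * Power series and SVEP *)

Section PowerSeries.
Variables (R : realType) (Y : normedModType R[i]) (K : R).
Hypotheses (cY : geom_complete Y) (K0 : 0 < K).
Implicit Types (x y : nat -> Y) (z w : R[i]).

Definition geom_bounded x := exists M, forall k, nr (x k) <= M * K ^+ k.

(** For such [w] the terms of a [geom_bounded] series are at most [M / 2 ^+ k], the rate that
    [geom_complete] asks for. *)
Definition small w := nr w * K <= 2^-1.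

Let psum x w n := \sum_(k < n) w ^+ k *: x k.

Definition has_psum x w l := exists C, forall n, nr (psum x w n - l) <= C / 2 ^+ n.

Lemma has_psum_uniq x w l l' : has_psum x w l -> has_psum x w l' -> l = l'.
Proof. by move=> [C h] [C' h']; exact: geom_limit_uniq h h'. Qed.

Let term_bound x w M : (forall k, nr (x k) <= M * K ^+ k) -> small w ->
  forall k, nr (w ^+ k *: x k) <= M / 2 ^+ k.
Proof.
move=> xM sw k; rewrite nrZ nrX.
have M0 : 0 <= M by have := le_trans (nr_ge0 _) (xM 0%N); rewrite expr0 mulr1.
apply: (@le_trans _ _ (nr w ^+ k * (M * K ^+ k))).
  by rewrite ler_wpM2l ?exprn_ge0 ?nr_ge0.
rewrite mulrCA -exprMn ler_wpM2l// -exprVn lerXn2r ?nnegrE ?mulr_ge0 ?nr_ge0 ?(ltW K0)//.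
Qed.

Let psumS x w n : psum x w n.+1 = psum x w n + w ^+ n *: x n.
Proof. by rewrite /psum big_ord_recr. Qed.

Let psumSl x w n : psum x w n.+1 = x 0%N + w *: psum (fun k => x k.+1) w n.
Proof.
rewrite /psum big_ord_recl expr0 scale1r scaler_sumr; congr (_ + _).
by apply: eq_bigr => i _; rewrite scalerA -exprS.
Qed.

Lemma has_psum_ex x w M : (forall k, nr (x k) <= M * K ^+ k) -> small w ->
  exists2 l, has_psum x w l & nr l <= 2 * M.
Proof.
move=> xM sw; have [k|l lP] := cY (u := psum x w) (M := M).
  by rewrite psumS addrC addKr; exact: term_bound.
exists l; first by exists (2 * M).
by have := lP 0%N; rewrite /psum big_ord0 sub0r nrN expr0 divr1.
Qed.

Lemma has_psum_shift x w l : has_psum (fun k => x k.+1) w l -> has_psum x w (x 0%N + w *: l).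
Proof.
(* The maximum takes care of the empty partial sum; the factor 2 pays for the shift of the index. *)
move=> [C lC]; exists (Num.max (nr (x 0%N + w *: l)) (2 * nr w * C)) => -[|n].
  by rewrite /psum big_ord0 sub0r nrN expr0 divr1 le_max lexx.
rewrite psumSl opprD addrACA subrr add0r -scalerBr nrZ.
apply: (@le_trans _ _ (2 * nr w * C / 2 ^+ n.+1)); last first.
  by rewrite ler_wpM2r ?invr_ge0 ?exprn_ge0// le_max lexx orbT.
have := lC n; move/(ler_wpM2l (nr_ge0 w)) => /le_trans; apply.
by rewrite exprS invfM; set t := (2 ^+ n)^-1; lra.
Qed.

(* The difference quotient of a power series is again a power series, with
   coefficients [H k.+1] where [H k] is the sum of the tail [x k, x k.+1, ...] *)
Lemma psum_diff x z : geom_bounded x -> small z -> exists2 y, geom_bounded y &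
  forall w l lz q, small w -> has_psum x w l -> has_psum x z lz -> has_psum y w q ->
    l = lz + (w - z) *: q.
Proof.
move=> [M xM] sz.
have M0 : 0 <= M by have := le_trans (nr_ge0 _) (xM 0%N); rewrite expr0 mulr1.
have xiM i k : nr (x (k + i)%N) <= (M * K ^+ i) * K ^+ k.
  by rewrite -mulrA -exprD addnC.
have /choice[H HP] i : exists h, has_psum (fun k => x (k + i)%N) z h /\
    nr h <= 2 * (M * K ^+ i).
  by have [h] := has_psum_ex (xiM i) sz; exists h.
have HS i : H i = x i + z *: H i.+1.
  apply: (has_psum_uniq (HP i).1).
  have := @has_psum_shift (fun k => x (k + i)%N) z (H i.+1).
  rewrite /= add0n; apply; have := (HP i.+1).1.
  by congr has_psum; apply/funext => k; rewrite addnS.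
exists (fun k => H k.+1).
  by exists (2 * M * K) => k; have [_] := HP k.+1; rewrite exprS !mulrA.
move=> w l lz q sw lw lzz qw.
have -> : lz = H 0%N.
  apply: has_psum_uniq lzz _; have := (HP 0%N).1.
  by congr has_psum; apply/funext => k; rewrite addn0.
(* Telescoping by means of [H n = x n + z *: H n.+1]. *)
have partial n : (w - z) *: psum (fun k => H k.+1) w n = psum x w n + w ^+ n *: H n - H 0%N.
  elim: n => [|n IH].
    by rewrite /psum !big_ord0 scaler0 add0r expr0 scale1r subrr.
  rewrite !psumS scalerDr IH scalerBl !scalerA -exprS.
  rewrite (HS n) scalerDr scalerA.
  rewrite (mulrC z) !addrA [LHS](ACl ((1*2*5*4)*(3*6)))/=.
  by rewrite subrr addr0.
have [C lC] := lw; have [C' qC] := qw.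
apply: (@geom_limit_uniq _ _ (fun n => psum x w n) C (2 * M + nr (w - z) * C')) => // n.
have -> : psum x w n - (H 0%N + (w - z) *: q) =
    (w - z) *: (psum (fun k => H k.+1) w n - q) - w ^+ n *: H n.
  rewrite scalerBr partial opprD !addrA [RHS](ACl ((1*3*4)*(2*5)))/=.
  by rewrite subrr addr0.
apply: le_trans (nrD _ _) _; rewrite nrN addrC mulrDl lerD//.
  apply: (term_bound (x := H)) => // k; have [_] := HP k.
  by rewrite mulrA.
by rewrite nrZ -mulrA ler_wpM2l ?nr_ge0.
Qed.

End PowerSeries.

Section Analytic.
Variables (R : realType) (Y : normedModType R[i]) (K : R).
Hypotheses (cY : geom_complete Y) (K0 : 0 < K).

(** Taking difference quotients twice gives [f (h + z) = f z + h *: (q + h *: p)] with [p] bounded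
    independently of [h], so [q] is the derivative. *)
Lemma psum_derivable (x : nat -> Y) (f : R[i] -> Y) (l z : R[i]) :
  geom_bounded K x ->
  (forall w, small K (w - l) -> has_psum x (w - l) (f w)) ->
  nr (z - l) * K < 2^-1 -> derivable f z 1.
Proof.
move=> bx fx zl; have sz : small K (z - l) by exact: ltW.
have [y by_ yP] := psum_diff cY K0 bx sz.
have [M yM] := by_.
have [q qz _] := has_psum_ex cY K0 yM sz.
have [y2 [M2 y2M] y2P] := psum_diff cY K0 by_ sz.
(* Increments shorter than [d] keep [h + z] in the disc where the series converges. *)
pose d := (2^-1 - nr (z - l) * K) / K.
have d0 : 0 < d by rewrite divr_gt0 ?subr_gt0.
have key h : nr h < d -> exists2 p, f (h + z) = f z + h *: (q + h *: p) & nr p <= 2 * M2.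
  move=> hd; have sh : small K (h + z - l).
    rewrite /small -addrA; apply: (@le_trans _ _ ((nr h + nr (z - l)) * K)).
      by rewrite ler_pM2r// nrD.
    by move: hd; rewrite /d ltr_pdivlMr// mulrDl; lra.
  have [qh qhP _] := has_psum_ex cY K0 yM sh.
  have [p pP pM] := has_psum_ex cY K0 y2M sh.
  have hz : h + z - l - (z - l) = h by rewrite opprB addrA subrK addrK.
  exists p => //; rewrite (yP _ _ _ _ sh (fx _ sh) (fx _ sz) qhP).
  by rewrite (y2P _ _ _ _ sh qhP qz pP) hz.
apply/cvg_ex; exists q => A /nbhs_nr[e e0 eA].
have M20 : 0 <= M2 by have := le_trans (nr_ge0 _) (y2M 0%N); rewrite expr0 mulr1.
pose r := Num.min d (e / (2 * M2 + 1)).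
apply/(@nbhs_nr R R[i]); exists r.
  by rewrite lt_min d0 divr_gt0//; lra.
move=> h; rewrite sub0r nrN lt_min => /andP[hd he] h0.
apply: eA => /=.
rewrite -[h *: 1]/(h * 1) mulr1; have [p -> pM] := key _ hd.
rewrite [f z + _]addrC addrK scalerA mulVf// scale1r opprD addrA subrr add0r nrN nrZ.
apply: (@le_lt_trans _ _ (nr h * (2 * M2))); first by rewrite ler_wpM2l ?nr_ge0.
move: he; rewrite ltr_pdivlMr; last by lra.
by apply: le_lt_trans; rewrite ler_wpM2l ?nr_ge0//; lra.
Qed.

End Analytic.

Section SVEPkernel.
Variables (R : realType) (Y : normedModType R[i]).
Hypothesis (cY : geom_complete Y).
Implicit Types (T : bop Y Y).

Lemma sub_scalarE T l x : sub_scalar T l x = T x - l *: x.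
Proof. by []. Qed.

(* The local form of SVEP that only looks at small discs; unlike [SVEP_at] it
   follows from injectivity of T - z for z <> lambda near lambda without the
   identity theorem. *)
Definition svep_near T (l : R[i]) := exists2 r0 : R, 0 < r0 &
  forall r : R, 0 < r -> r < r0 -> forall f : R[i] -> Y,
    analytic_on (ball l r%:C%C) f ->
    (forall z, ball l r%:C%C z -> sub_scalar T z (f z) = 0) -> f l = 0.

Lemma SVEP_svep_near T l : SVEP_at T l -> svep_near T l.
Proof.
move=> svep; exists 1 => // r r0 _ f fa f0; apply: (svep r%:C%C) => //.
  by rewrite ltcR.
by rewrite -ball_normE /= subrr normr0 ltcR.
Qed.

(** A local solution vanishes off [l], so its difference quotient at [l] is [- f l / h]; since this
    converges, [f l] must be 0. *)
Lemma injective_svep_near T l (r : R) : 0 < r ->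
  (forall z, z != l -> nr (z - l) < r -> forall x, sub_scalar T z x = 0 -> x = 0) ->
  svep_near T l.
Proof.
move=> r0 inj; exists r => // r' r'0 rr' f fa fT.
have ballE z : ball l r'%:C%C z = (nr (z - l) < r') :> Prop.
  by rewrite -ball_normE /= nr_lt nrC.
have f0 z : z != l -> nr (z - l) < r' -> f z = 0.
  move=> zl zr; apply: (inj z zl); first exact: lt_trans zr rr'.
  by apply: fT; rewrite ballE.
have /cvg_ex[q fq] : derivable f l 1 by apply: fa; rewrite ballE subrr nr0.
have /fq/(@nbhs_nr R R[i])[d d0 dP] : nbhs q [set y | nr (q - y) < 1].
  by apply/nbhs_nr; exists 1.
apply: nr_small => e e0.
pose h : R := Num.min (Num.min d r') (e / (nr q + 1)) / 2.
have q0 := nr_ge0 q.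
have [h0 hd hr he] : [/\ 0 < h, h < d, h < r' & h < e / (nr q + 1)].
  have m0 : 0 < Num.min (Num.min d r') (e / (nr q + 1)).
    by rewrite !lt_min d0 r'0 divr_gt0//; lra.
  have : Num.min (Num.min d r') (e / (nr q + 1)) <= Num.min (Num.min d r') (e / (nr q + 1)) by [].
  by rewrite !le_min -andbA => /and3P[m1 m2 m3]; split; rewrite /h; lra.
have hC : h%:C%C != 0 :> R[i] by rewrite (inj_eq (@complexI R)) gt_eqF.
have := dP h%:C%C _ hC; rewrite sub0r nrN nr_real gtr0_norm// => /(_ hd) /=.
rewrite -[h%:C%C *: 1]/(h%:C%C * 1) mulr1 f0; last 2 first.
- by rewrite -subr_eq0 addrK.
- by rewrite addrK nr_real gtr0_norm.
rewrite sub0r scalerN opprK => qf.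
have : nr (h%:C%C^-1 *: f l) < nr q + 1.
  have -> : h%:C%C^-1 *: f l = (q + h%:C%C^-1 *: f l) - q by rewrite addrC addKr.
  by apply: le_lt_trans (nrD _ _) _; rewrite nrN; lra.
rewrite -fmorphV nrZ nr_real gtr0_norm ?invr_gt0//.
rewrite mulrC ltr_pdivrMr// => /ltW/le_trans; apply.
by rewrite mulrC -ler_pdivlMr ?ltW//; lra.
Qed.

(* If a geometrically bounded backward orbit x 0 <- x 1 <- x 2 <- ... of S =
   T - lambda starts in the kernel of S, then sum_k (z - lambda)^k x k is an
   eigenvector of T at z. *)
Lemma svep_surjective T (l : R[i]) (D : set Y) : svep_near T l ->
  subsp D -> closed D -> sub_scalar T l @` D = D ->
  forall x, D x -> sub_scalar T l x = 0 -> x = 0.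
Proof.
move=> [r1 r10 svep] sD cD SD x0 Dx0 Sx0; set S := sub_scalar T l in SD Sx0.
have [|K K0 lift] := open_mapping cY sD cD cY (T := S); first by rewrite SD.
have /choice[g gP] y : exists x, D y -> [/\ D x, S x = y & nr x <= K * nr y].
  have [Dy|nD] := pselect (D y); last by exists 0.
  by have [|x xP] := lift y; [rewrite SD|exists x].
pose x k := iter k g x0.
have Dx k : D (x k) by elim: k => [|k IH] //=; case: (gP _ IH).
have Sx k : S (x k.+1) = x k by case: (gP _ (Dx k)).
have bx : geom_bounded K x.
  exists (nr x0) => k; elim: k => [|k IH]; first by rewrite expr0 mulr1.
  have [_ _ /le_trans] := gP _ (Dx k); apply.
  by rewrite exprS mulrCA ler_pM2l.
have [M xM] := bx.
pose f z := xget 0 (has_psum x (z - l)).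
have fP z : small K (z - l) -> has_psum x (z - l) (f z).
  move=> /(has_psum_ex cY K0 xM)[y yP _]; rewrite /f; case: xgetP => // h.
  by case: (h y).
(* The first bound puts the disc inside the domain of the series; the second makes the radius
   admissible for [svep_near]. *)
pose r := Num.min (4 * K)^-1 (r1 / 2).
have r0 : 0 < r by rewrite lt_min invr_gt0 mulr_gt0//; lra.
have rr1 : r < r1 by rewrite gt_min; apply/orP; right; lra.
have ballE z : ball l r%:C%C z -> nr (z - l) * K < 2^-1.
  rewrite -ball_normE /= nr_lt lt_min nrC => /andP[h _].
  have : nr (z - l) * K < (4 * K)^-1 * K by rewrite ltr_pM2r.
  rewrite invfM -mulrA mulVf ?gt_eqF// mulr1 => /lt_trans; apply.
  by rewrite ltf_pV2 ?posrE//; lra.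
have f0 : f l = x0.
  have sl : small K (l - l) by rewrite /small subrr nr0 mul0r invr_ge0.
  apply: has_psum_uniq (fP l sl) _.
  have [y yP _] := has_psum_ex cY K0 (x := fun k => x k.+1) (M := M * K)
     (fun k => ltac:(by rewrite -mulrA -exprS)) sl.
  have := has_psum_shift yP; rewrite subrr scale0r addr0; exact.
rewrite -f0; apply: (svep r r0 rr1 f).
  move=> z /ballE zl; exact: (psum_derivable cY K0 bx fP zl).
move=> z /ballE zl; have sz : small K (z - l) by exact: ltW.
have -> : sub_scalar T z (f z) = S (f z) - (z - l) *: f z.
  by rewrite /S !sub_scalarE scalerBl opprB addrA subrK.
apply/eqP; rewrite subr_eq0; apply/eqP.
have [L L0 SL] := bop_bound S.
have [y yP _] := has_psum_ex cY K0 (x := fun k => x k.+1) (M := M * K)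
     (fun k => ltac:(by rewrite -mulrA -exprS)) sz.
have fy : f z = x0 + (z - l) *: y.
  exact: has_psum_uniq (fP z sz) (has_psum_shift yP).
rewrite fy bopD Sx0 add0r bopZ; congr (_ *: _).
(* [S] sends the partial sums of the shifted series to those of [x], so [S y] is again the sum
   [f z]. *)
rewrite -fy; apply: has_psum_uniq (fP z sz).
have [C yC] := yP; exists (L * C) => n.
have := SL (\sum_(k < n) (z - l) ^+ k *: x k.+1 - y); rewrite bopB.
have -> : S (\sum_(k < n) (z - l) ^+ k *: x k.+1) = \sum_(k < n) (z - l) ^+ k *: x k.
  rewrite (_ : S _ = \sum_(k < n) S ((z - l) ^+ k *: x k.+1)); last exact: linear_sum.
  by apply: eq_bigr => k _; rewrite bopZ Sx.
by move=> /le_trans; apply; rewrite -mulrA ler_pM2l.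
Qed.

Lemma nonincreasing_nat_stable (rho : nat -> nat) : (forall k, rho k.+1 <= rho k)%N ->
  exists k0, forall k, (k0 <= k)%N -> rho k = rho k0.
Proof.
move=> dec.
have [k0 [_ k0min]] : exists k0, True /\ forall k, (rho k0 <= rho k)%N.
  have exP : exists n, `[< exists k, rho k = n >] by exists (rho 0%N); apply/asboolP; exists 0%N.
  case: (ex_minnP exP) => _ /asboolP[k <-] kmin.
  by exists k; split=> // j; apply: kmin; apply/asboolP; exists j.
exists k0; elim=> [|k IH]; first by rewrite leqn0 => /eqP ->.
rewrite leq_eqVlt => /predU1P[<-//|]; rewrite ltnS => /IH rk.
by apply/eqP; rewrite eqn_leq k0min -rk dec.
Qed.

(* rho_k = dim R_k / R_(k+1), with R_k = range S^k, is nonincreasing; once it is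
   constant, ker S meets R_k inside the intersection D of all R_k and S maps D onto
   D, so that SVEP makes S injective on R_k. *)
Lemma svep_range_cofinite T l (S := sub_scalar T l) : svep_near T l ->
  qfin setT (range S) -> exists k s rho,
  [/\ forall x, range (bop_exp S k) x -> S x = 0 -> x = 0, qdim (ker S) [set 0] s,
      qdim (range (bop_exp S k)) (range (bop_exp S k.+1)) rho &
      qdim setT (range S) (s + rho)].
Proof.
move=> svep [b Sb].
pose Rk k := range (bop_exp S k).
have sR k : subsp (Rk k) by exact: subsp_range.
have RS k : Rk k.+1 = S @` Rk k by exact: range_expS.
have Rle k : Rk k.+1 `<=` Rk k by exact: range_exp_le.
have R0 : Rk 0%N = setT by apply/seteqP; split=> // x _; exists x.
(* [P k] is R_(k+1) plus the part of [ker S] in R_k. [S] induces an isomorphism from R_k / P_k onto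
   R_(k+1) / R_(k+2), so [rho] drops from [k] to [k.+1] by the dimension of P_k / R_(k+1). *)
pose P k := [set x | Rk k x /\ Rk k.+2 (S x)].
have sP k : subsp (P k).
  by apply: subspI => //; exact: (subsp_preimage (bop_linear S) (sR k.+2)).
have RP k : Rk k.+1 `<=` P k.
  by move=> x Rx; split; [exact: Rle|rewrite RS; exists x].
have PR k : P k `<=` Rk k by move=> x [].
have Piso k n : qdim (Rk k) (P k) n <-> qdim (Rk k.+1) (Rk k.+2) n.
  apply: (qdim_iso (bop_linear S)) => //.
  - by move=> v Rv; rewrite RS; exists v.
  - by move=> v'; rewrite RS => -[v Rv <-]; exists v; rewrite ?subrr//; exact: subsp0.
  - by move=> v Rv; split=> [?|[]].
have rhoS k m : qdim (Rk k) (Rk k.+1) m ->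
    exists a c, [/\ qdim (Rk k.+1) (Rk k.+2) a, qdim (P k) (Rk k.+1) c & (a + c = m)%N].
  move=> /(qdim_sub (sR k) (sP k) (sR k.+1) (@RP k) (@PR k))[a [c [/Piso qa qc ac]]].
  by exists a, c.
have /choice[rho rhoP] k : exists m, qdim (Rk k) (Rk k.+1) m.
  elim: k => [|k [m /rhoS[a [c [qa _ _]]]]]; last by exists a.
  by exists b; rewrite R0 RS R0.
have [|k0 k0P] := @nonincreasing_nat_stable rho.
  move=> k; have [a [c [qa _ <-]]] := rhoS k _ (rhoP k).
  by rewrite (qdim_uniq (sR k.+2) (rhoP k.+1) qa) leq_addr.
have PRk k : (k0 <= k)%N -> P k `<=` Rk k.+1.
  move=> kk; have [a [c [qa qc ac]]] := rhoS k _ (rhoP k).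
  have : (a = rho k.+1)%N by exact: qdim_uniq (sR k.+2) qa (rhoP k.+1).
  rewrite !k0P// in ac *; last by exact: leqW.
  move=> aE; move: ac; rewrite aE => /eqP; rewrite -[X in _ == X]addn0 eqn_add2l => /eqP c0.
  by apply: qdim0_sub; rewrite -c0.
pose D := [set x | forall k, Rk k x].
have sD : subsp D.
  by split=> [k|a x y Dx Dy k]; [exact: subsp0|case: (sR k) => _; apply].
have qR k : qfin setT (Rk k).
  elim: k => [|k [n qn]]; first by exists 0%N; rewrite R0; apply: qdim0.
  by exists (n + rho k)%N; apply: qdim_add (rhoP k) => //.
have cD : closed D.
  rewrite (_ : D = \bigcap_(k in setT) Rk k).
    by apply: closed_bigI => k _; exact: (closed_range_cofinite cY (qR k)).
  by apply/seteqP; split=> x h k => [_|]; apply: h.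
have toD k x : Rk k0 x -> Rk k.+1 (S x) -> Rk k x.
  move=> Rx; have [kk|/ltnW kk] := leqP k k0.
    by move=> _; exact: range_exp_le kk _ Rx.
  elim: k kk => [|k IH]; first by rewrite R0.
  rewrite leq_eqVlt => /predU1P[<-//|]; rewrite ltnS => kk RSx.
  by apply: (PRk k kk); split=> //; apply: IH => //; exact: Rle.
have SD : S @` D = D.
  apply/seteqP; split=> [_ [x Dx <-] k|y Dy].
    by apply: Rle; rewrite RS; exists x.
  have := Dy k0.+1; rewrite RS => -[x Rx xy].
  by exists x => // k; apply: toD => //; rewrite xy.
have inj x : Rk k0 x -> S x = 0 -> x = 0.
  move=> Rx Sx; apply: (svep_surjective svep sD cD SD) => // k.
  by apply: toD => //; rewrite Sx; exact: subsp0.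
(* The codimension of R_(k0+1) is counted through R_1 and through R_k0. The preimage [P'] of
   R_(k0+1) links the counts: X / P' is R_1 / R_(k0+1), and P' / R_k0 is [ker S]. *)
have [m qm] := qR k0.
have q1 : qdim setT (Rk k0.+1) (m + rho k0) by exact: qdim_add (rhoP k0).
have R1 : Rk 1%N = range S by rewrite RS R0.
have [||bt [t [qbt qt btE]]] := qdim_sub (@subspT _ Y) (sR 1%N) (sR k0.+1) _ _ q1.
- exact: range_exp_le.
- by [].
pose P' := S @^-1` Rk k0.+1.
have sP' : subsp P' by exact: (subsp_preimage (bop_linear S) (sR k0.+1)).
have qt' : qdim setT P' t.
  apply/(qdim_iso (bop_linear S) (V' := Rk 1%N) (W' := Rk k0.+1)) => //.
  - by move=> v _; rewrite R1; exists v.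
  - by rewrite R1 => _ [v _ <-]; exists v; rewrite ?subrr//; exact: subsp0.
have RP' : Rk k0 `<=` P' by move=> x Rx; rewrite /P' /preimage /= RS; exists x.
have [//|t' [s [qt2 qs tsE]]] := qdim_sub (@subspT _ Y) sP' (sR k0) RP' _ qm.
have tt : t' = t by exact: qdim_uniq sP' qt2 qt'.
exists k0, s, (rho k0); split=> //.
- apply/(qdim_iso (f := idfun) (fun _ _ _ => erefl) (V' := P') (W' := Rk k0)) => //=.
  + by move=> v kv; rewrite /P' /preimage /mkset (kv : S v = 0); exact: subsp0.
  + rewrite /P' => x; rewrite /preimage /mkset RS => -[u Ru uE].
    by exists (x - u); [rewrite /Defs.ker /mkset bopB uE subrr|rewrite opprB addrC subrK].
  + move=> v kv; split=> [Rv|->]; [exact: inj|exact: subsp0].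
  + exact: subsp_ker.
- exact: rhoP.
- rewrite -R1 (_ : s + rho k0 = bt)%N//; apply/eqP.
  by rewrite -(eqn_add2r t) btE -tsE tt [(t + s)%N]addnC addnAC.
Qed.

End SVEPkernel.

(** * Annihilators and adjoints *)

Section Annihilator.
Variables (R : realType) (X : normedModType R[i]).
Implicit Types (W U : set X).

Definition annihilator W : set (dual X) :=
  [set phi | forall w, W w -> (phi : bop X R[i]) w = 0].

Lemma dual_sum n (c : 'I_n -> R[i]) (phi : 'I_n -> dual X) x :
  (\sum_i c i *: phi i : bop X R[i]) x = \sum_i c i * (phi i : bop X R[i]) x.
Proof. by elim/big_ind2: _ => [//|f a g b <- <-|]. Qed.

Lemma subsp_annihilator W : subsp (annihilator W).
Proof.
split=> [//|a f g fW gW w Ww].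
by rewrite -[LHS]/(a *: (f : bop X R[i]) w + (g : bop X R[i]) w) fW// gW// scaler0 addr0.
Qed.

(** Each [v i] is separated from the span of [W] and the other [v j], which is closed as a finite
    extension of [W]. *)
Lemma biorthogonal W n (v : 'I_n -> X) : subsp W -> closed W -> indep W v ->
  exists phi : 'I_n -> dual X, (forall i, annihilator W (phi i)) /\
    forall i j, (phi i : bop X R[i]) (v j) = (j == i)%:R.
Proof.
move=> sW cW iv.
suff /choice[phi phiP] i : exists f : dual X, annihilator W f /\
    forall j, (f : bop X R[i]) (v j) = (j == i)%:R.
  by exists phi; split=> [i|i j]; case: (phiP i).
(* Used with two conditions on the coefficients: none, and vanishing of the [i]-th one. *)
pose span (P : ('I_n -> R[i]) -> Prop) :=
  [set x | exists c, P c /\ W (x - \sum_j c j *: v j)].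
pose lin (P : ('I_n -> R[i]) -> Prop) := P (fun=> 0) /\
  forall a c d, P c -> P d -> P (fun j => a * c j + d j).
have span_sub P : lin P -> subsp (span P).
  move=> [P0 Pl]; split=> [|a x y [c [Pc Wc]] [d [Pd Wd]]].
    exists (fun=> 0); split=> //; rewrite big1 ?subr0; first exact: subsp0.
    by move=> j _; rewrite scale0r.
  exists (fun j => a * c j + d j); split; first exact: Pl.
  under eq_bigr do rewrite scalerDl -scalerA.
  rewrite big_split -scaler_sumr opprD addrACA -scalerBr.
  by case: sW => _; apply.
have span_ge P : lin P -> W `<=` span P.
  move=> [P0 _] x Wx; exists (fun=> 0); split=> //.
  by rewrite big1 ?subr0// => j _; rewrite scale0r.
have linT : lin (fun=> True) by [].
have lin0 : lin (fun c => c i = 0).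
  by split=> // a c d -> ->; rewrite mulr0 addr0.
have vT : qdim (span (fun=> True)) W n.
  exists v; split=> // [j|x [c [_ Wc]]]; last by exists c.
  exists (fun k => (k == j)%:R); split=> //.
  rewrite (bigD1 j)//= eqxx scale1r big1 ?addr0 ?subrr; first exact: subsp0.
  by move=> k /negPf ->; rewrite scale0r.
have cl : closed (span (fun c => c i = 0)).
  apply: (closed_qfin _ sW) => //; [exact: span_sub|exact: span_ge|].
  have [||a [b [_ qb _]]] := qdim_sub (span_sub _ linT) (span_sub _ lin0) sW _ _ vT.
  - exact: span_ge.
  - by move=> x [c [_ Wc]]; exists c.
  - by exists b.
have [|phi [phi0 phi1]] := hahn_banach_sep (v := v i) (span_sub _ lin0) cl.
  move=> [c [ci Wc]].
  suff /iv/(_ i) : W (\sum_j ((j == i)%:R - c j) *: v j).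
    by move/eqP; rewrite eqxx ci subr0 oner_eq0.
  under eq_bigr do rewrite scalerBl.
  rewrite sumrB (bigD1 i)//= eqxx scale1r big1 ?addr0//.
  by move=> k /negPf ->; rewrite scale0r.
exists phi; split=> [w Ww|j]; first by apply: phi0; exact: span_ge.
have [->//|ji] := eqVneq j i.
apply: phi0; exists (fun k => (k == j)%:R); split; first by rewrite eq_sym (negPf ji).
rewrite (bigD1 j)//= eqxx scale1r big1 ?addr0 ?subrr; first exact: subsp0.
by move=> k /negPf ->; rewrite scale0r.
Qed.

(** Functionals biorthogonal to a basis of U/W form a basis of the quotient of annihilators, which
    is the dual of U/W. *)
Lemma qdim_annihilator U W n : subsp W -> closed W -> W `<=` U ->
  qdim U W n -> qdim (annihilator W) (annihilator U) n.
Proof.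
move=> sW cW WU [v [Uv iv sv]].
have [phi [phiW phiv]] := biorthogonal sW cW iv.
have phic c j : (\sum_i c i *: phi i : bop X R[i]) (v j) = c j.
  rewrite dual_sum (bigD1 j)//= phiv eqxx mulr1 big1 ?addr0// => k kj.
  by rewrite phiv eq_sym (negPf kj) mulr0.
exists phi; split=> // [c cU j|f fW].
  by rewrite -(phic c) (cU _ (Uv j)).
exists (fun i => (f : bop X R[i]) (v i)) => u Uu.
have [c Wc] := sv u Uu.
set g := (_ - _); have gv j : (g : bop X R[i]) (v j) = 0.
  by rewrite /g -[LHS]/((f : bop X R[i]) (v j) - (\sum_i _ : bop X R[i]) (v j)) phic subrr.
have gW : annihilator W g.
  have sA := subsp_annihilator W; apply: (subspB sA fW).
  apply: (subsp_sum _ _ sA) => i; exact: (subspZ _ sA).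
rewrite -[u](subrK (\sum_i c i *: v i)) bopD gW// add0r.
rewrite [LHS](_ : _ = \sum_i (g : bop X R[i]) (c i *: v i)); last exact: linear_sum.
by rewrite big1// => i _; rewrite bopZ gv scaler0.
Qed.

(** Functionals biorthogonal to a family independent modulo [W] are themselves independent, so such
    families have length at most [n] and X/W is finite-dimensional. *)
Lemma qdim_annihilator0 W n : subsp W -> closed W ->
  qdim (annihilator W) [set 0] n -> qdim setT W n.
Proof.
move=> sW cW An.
have s0 := @subsp_zero _ (dual X).
have [m qm] : qfin setT W.
  apply: (@indep_qfin _ _ setT W n) => // m v _ iv.
  have [phi [phiW phiv]] := biorthogonal sW cW iv.
  have [f [_ _ fs]] := An.
  apply: (indep_le s0 (v := phi) (e := f)) => [c c0 j|i]; last exact: fs.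
  have := congr1 (fun g : bop X R[i] => g (v j)) (c0 : _ = _).
  rewrite /= dual_sum (bigD1 j)//= phiv eqxx mulr1 big1 ?addr0// => k kj.
  by rewrite phiv eq_sym (negPf kj) mulr0.
suff -> : n = m by [].
apply: (qdim_uniq s0 An).
have := qdim_annihilator sW cW (@subsetT _ W) qm.
congr qdim; apply/seteqP; split=> [f fT|_ -> //].
by apply: bop_ext => x; exact: fT.
Qed.

End Annihilator.

Section Adjoint.
Variables (R : realType) (X : normedModType R[i]).
Hypothesis (cX : geom_complete X).
Implicit Types (T S : bop X X).

Lemma sub_scalar_adjoint T l : sub_scalar (adjoint T) l = adjoint (sub_scalar T l).
Proof.
apply: bop_ext => phi; apply: bop_ext => x.
rewrite -[LHS]/((phi : bop X R[i]) (T x) - l *: (phi : bop X R[i]) x).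
by rewrite -bopZ -bopB.
Qed.

Lemma ker_adjoint S : ker (adjoint S) = annihilator (range S).
Proof.
apply/seteqP; split=> phi /=.
  move=> /= S0 _ [x _ <-].
  exact: (congr1 (fun f : bop X R[i] => f x) (S0 : adjoint S phi = 0)).
by move=> h; apply: bop_ext => x; apply: h; exists x.
Qed.

(** Closed range theorem: a functional vanishing on [ker S] factors through [S]; bounded lifts make
    the factor continuous on the range, and Hahn-Banach extends it. *)
Lemma range_adjoint S : closed (range S) -> range (adjoint S) = annihilator (ker S).
Proof.
move=> cS; apply/seteqP; split=> [_ [phi _ <-] x /= Sx|phi phik].
  by rewrite (Sx : S x = 0) bop0.
have [K K0 lift] := lift_range cX cS.
have /choice[s sP] y : exists x, range S y -> S x = y /\ nr x <= K * nr y.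
  by have [/lift[x ? ?]|nS] := pselect (range S y); [exists x|exists 0].
have phis x y : S x = S y -> (phi : bop X R[i]) x = (phi : bop X R[i]) y.
  move=> xy; apply/subr0_eq; rewrite -bopB; apply: phik.
  by rewrite /ker /= bopB xy subrr.
have [M M0 phiM] := bop_bound (phi : bop X R[i]).
have [|a x y rx ry|x /sP[_ sx]|psi psiE] := @hahn_banach _ _ (range S)
  (fun y => (phi : bop X R[i]) (s y)) (M * K) (subsp_range S).
- by rewrite mulr_ge0 ?ltW.
- rewrite -[_ * _ + _]/(a *: (phi : bop X R[i]) (s x) + (phi : bop X R[i]) (s y)).
  rewrite -bopZ -bopD; apply: phis; rewrite bopD bopZ.
  rewrite (sP x rx).1 (sP y ry).1; apply: (sP _ _).1.
  by case: (subsp_range S) => _; apply.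
- by apply: le_trans (phiM _) _; rewrite -mulrA ler_pM2l.
exists psi => //; apply: bop_ext => x /=.
rewrite psiE; last by exists x.
by apply: phis; apply: (sP _ _).1; exists x.
Qed.

(** By duality the kernel and cokernel of the adjoint have the dimensions of the cokernel and kernel
    of [S], so [svep_range_cofinite] for the adjoint bounds the codimension by [n]. *)
Lemma svep_adjoint T l (S := sub_scalar T l) n : svep_near (adjoint T) l ->
  closed (range S) -> qdim (ker S) [set 0] n ->
  exists s rho, qdim setT (range S) s /\ n = (s + rho)%N.
Proof.
move=> svep cS kn; rewrite /S in cS kn *.
have := @svep_range_cofinite _ _ (@dual_geom_complete _ X) (adjoint T) l svep.
rewrite sub_scalar_adjoint => /(_ _)[|k [s [rho [_ qs _ qsr]]]].
  exists n; rewrite range_adjoint//.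
  rewrite (_ : setT = annihilator [set 0]).
    apply: qdim_annihilator kn; [exact: subsp_zero|exact: closed_zero|].
    by move=> _ ->; exact: subsp0 (subsp_ker _).
  by apply/seteqP; split=> // phi _ _ ->; exact: bop0.
exists s, rho; split.
  by apply: qdim_annihilator0 => //; [exact: subsp_range|rewrite -ker_adjoint].
have sR := subsp_range (adjoint (sub_scalar T l)).
apply: (qdim_uniq sR _ qsr); rewrite range_adjoint//.
rewrite (_ : setT = annihilator [set 0]).
  apply: qdim_annihilator kn; [exact: subsp_zero|exact: closed_zero|].
  by move=> _ ->; exact: subsp0 (subsp_ker _).
by apply/seteqP; split=> // phi _ _ ->; exact: bop0.
Qed.

End Adjoint.

(** * Ascent and descent *)

Section AscentDescent.
Variables (R : realType) (Y : normedModType R[i]).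
Implicit Types (S T : bop Y Y).

Lemma ker_expS S n : ker (bop_exp S n) `<=` ker (bop_exp S n.+1).
Proof. by move=> x kx; rewrite /Defs.ker /mkset /= (kx : bop_exp S n x = 0) bop0. Qed.

Lemma ker_exp_stable S m i : ker (bop_exp S m) = ker (bop_exp S m.+1) ->
  ker (bop_exp S (i + m)) = ker (bop_exp S m).
Proof.
move=> h; elim: i => [//|i IH]; rewrite -IH; apply/seteqP; split=> x kx.
  have : ker (bop_exp S m.+1) (bop_exp S i x).
    by rewrite /Defs.ker /mkset -bop_expD addSnnS addnC.
  by rewrite -h /Defs.ker /mkset -bop_expD addnC.
by rewrite /Defs.ker /mkset addSn /= (kx : bop_exp S (i + m) x = 0) bop0.
Qed.

Lemma range_exp_stable S m i : range (bop_exp S m) = range (bop_exp S m.+1) ->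
  range (bop_exp S (i + m)) = range (bop_exp S m).
Proof.
move=> h; elim: i => [//|i IH].
by rewrite addSn range_expS IH -range_expS -h.
Qed.

(** Finite ascent and finite descent are equal; each is bounded by the other. *)
Lemma ascent_descent S k j : ker (bop_exp S k) = ker (bop_exp S k.+1) ->
  range (bop_exp S j) = range (bop_exp S j.+1) ->
  exists p, is_ascent S p /\ is_descent S p.
Proof.
move=> hk hj.
pose a n := `[< ker (bop_exp S n) = ker (bop_exp S n.+1) >].
pose d n := `[< range (bop_exp S n) = range (bop_exp S n.+1) >].
have exa : exists n, a n by exists k; apply/asboolP.
have exd : exists n, d n by exists j; apply/asboolP.
case: (ex_minnP exa) => p /asboolP ap pmin.
case: (ex_minnP exd) => q /asboolP dq qmin.
(* For [x] in the kernel of S^(q+1), write S^q x = S^(p+q) u; then [u] is killed by a high power,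
   hence by S^p, and S^q x = 0. *)
have pq : (p <= q)%N.
  apply: pmin; apply/asboolP/seteqP; split=> x kx.
    by rewrite /Defs.ker /mkset /= (kx : bop_exp S q x = 0) bop0.
  have : range (bop_exp S (p + q)) (bop_exp S q x).
    by rewrite range_exp_stable//; exists x.
  move=> [u _ uE]; have : ker (bop_exp S (q.+1 + p)) u.
    rewrite /Defs.ker /mkset addSn addnC /= uE.
    exact: (kx : bop_exp S q.+1 x = 0).
  rewrite ker_exp_stable// => ku; rewrite /Defs.ker /mkset -uE addnC bop_expD.
  by rewrite (ku : bop_exp S p u = 0) bop0.
(* Write S^(p+q) x = S^(p+1+q) u; then [x - S u] is killed by a high power, hence by S^p. *)
have qp : (q <= p)%N.
  apply: qmin; apply/asboolP/seteqP; split; last exact: range_exp_le.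
  move=> _ [x _ <-].
  have : range (bop_exp S (p.+1 + q)) (bop_exp S (p + q) x).
    rewrite (range_exp_stable p.+1 dq) -(range_exp_stable p dq); by exists x.
  move=> [u _ uE]; have : ker (bop_exp S (q + p)) (x - S u).
    by rewrite /Defs.ker /mkset bopB -bop_expSr addnC -addSn uE subrr.
  rewrite ker_exp_stable// /Defs.ker /mkset bopB => /subr0_eq ->.
  by exists u => //; rewrite bop_expSr.
have e : p = q by apply/eqP; rewrite eqn_leq pq qp.
subst q; exists p; split; split=> // i ip h.
  by have := pmin i; rewrite leqNgt ip => /(_ (introT (asboolP _) h)).
by have := qmin i; rewrite leqNgt ip => /(_ (introT (asboolP _) h)).
Qed.

Hypothesis cY : geom_complete Y.

Lemma isolated_fredholm_polaroid T l (S := sub_scalar T l) r : 0 < r ->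
  (forall z, z != l -> nr (z - l) < r -> invertible (sub_scalar T z)) ->
  qfin (ker S) [set 0] -> qfin setT (range S) -> polaroid_at T l.
Proof.
move=> r0 inv fk [b cb].
have kz z : z != l -> nr (z - l) < r -> ker (sub_scalar T z) = [set 0].
  by move=> zl zr; have /(invertibleP cY)[] := inv z zl zr.
have [|k [s [rho [inj ks qrho qsr]]]] := svep_range_cofinite cY _ (ex_intro _ b cb).
  apply: (injective_svep_near r0) => z zl zr x xz.
  by have : ker (sub_scalar T z) x by []; rewrite kz.
have cS : closed (range S) by apply: closed_range_cofinite => //; exists b.
have [|t [t' [qt ts]]] := svep_adjoint cY (T := T) (l := l) _ cS ks.
  apply: (injective_svep_near r0) => z zl zr phi.
  rewrite sub_scalar_adjoint => phiz; apply: bop_ext => x.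
  have /(invertibleP cY)[_ rz] := inv z zl zr.
  have [y _ <-] : range (sub_scalar T z) x by rewrite rz.
  exact: (congr1 (fun f : bop Y R[i] => f y) phiz).
(* SVEP of [T] and of its adjoint bound kernel dimension and codimension by each other, so both
   defects vanish. *)
have rho0 : rho = 0%N.
  have := qdim_uniq (subsp_range S) qt qsr; rewrite ts -addnA => /eqP.
  rewrite -[X in X == _]addn0 eqn_add2l eq_sym addn_eq0.
  by move=> /andP[_ /eqP].
apply: (@ascent_descent S k k).
- apply/seteqP; split; first exact: ker_expS.
  by move=> x kx; apply: (inj _ _ kx); exists x.
- apply/seteqP; split; last exact: range_exp_le.
  by apply: qdim0_sub; rewrite -rho0.
Qed.

Lemma polaroid_surjective T l (S := sub_scalar T l) : polaroid_at T l ->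
  qfin (ker S) [set 0] -> qfin setT (range S) /\
  exists2 r, 0 < r & forall z, z != l -> nr (z - l) < r -> range (sub_scalar T z) = setT.
Proof.
move=> [p [[ap _] [dp _]]] fk; rewrite -/S in ap dp.
have s0 := @subsp_zero _ Y.
(* [bop_exp S n] embeds ker S^(n+1) / ker S^n into [ker S]. *)
have fN n : qfin (ker (bop_exp S n)) [set 0].
  elim: n => [|n [a qa]]; first by exists 0%N; apply: qdim0.
  pose V := bop_exp S n @` ker (bop_exp S n.+1).
  have sk m := subsp_ker (bop_exp S m).
  have sV : subsp V := subsp_image (bop_linear (bop_exp S n)) (sk n.+1).
  have [d qd] := fk.
  have [||a1 [b1 [_ qb _]]] := qdim_sub (subsp_ker S) sV s0 _ _ qd.
  - by move=> _ ->; exact: subsp0.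
  - by move=> _ [x kx <-].
  exists (b1 + a)%N; apply: qdim_add qa => //.
  - by move=> x ->; exact: subsp0.
  - exact: ker_expS.
  - apply/(qdim_iso (bop_linear (bop_exp S n)) (V' := V) (W' := [set 0])) => //.
    + by move=> v kv; exists v.
    + by move=> _ [x kx <-]; exists x => //; rewrite /= subrr.
pose N := ker (bop_exp S p); pose D := range (bop_exp S p).
have sN : subsp N by exact: subsp_ker.
have sD : subsp D by exact: subsp_range.
have SD : S @` D = D by rewrite -range_expS -dp.
have ND : sumsp D N = setT.
  apply/seteqP; split=> // x _.
  have : range (bop_exp S (p + p)) (bop_exp S p x).
    by rewrite range_exp_stable//; exists x.
  move=> [u _ uE]; exists (bop_exp S p u); first by exists u.
  by rewrite /N /Defs.ker /mkset bopB -bop_expD uE subrr.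
have [d qd] : qfin setT D by rewrite -ND; exact: qfin_sumsp sD sN (fN p).
have cD : closed D by apply: closed_range_cofinite => //; exists d.
have DS : D `<=` range S by rewrite -SD => _ [x _ <-]; exists x.
split.
  have [//|a [b [qa _ _]]] := qdim_sub (@subspT _ Y) (subsp_range S) sD DS _ qd.
  by exists a.
have [|K K0 lift] := open_mapping cY sD cD cY (T := S); first by rewrite SD.
(* With this radius a lift for [S] is a lift for [T'] with relative error at most 1/2, as
   [approx_lift] requires. *)
exists (2 * K)^-1; first by rewrite invr_gt0 mulr_gt0.
move=> z zl zr; set T' := sub_scalar T z.
have TE x : T' x = S x - (z - l) *: x.
  by rewrite /T' /S !sub_scalarE scalerBl opprB addrA subrK.
have sR : subsp (range T') by exact: subsp_range.
have Dr : D `<=` range T'.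
  move=> y Dy; have [|x [_ <- _]] := @approx_lift _ _ _ T' D cY sD cD D K _ y Dy; last by exists x.
  move=> v Dv; have [|x [Dx xv xn]] := lift v; first by rewrite SD.
  have vE : v - T' x = (z - l) *: x by rewrite TE xv subKr.
  exists x; split=> //; rewrite vE; last exact: subspZ.
  rewrite nrZ; apply: (@le_trans _ _ ((2 * K)^-1 * (K * nr v))).
    by rewrite ler_pM ?nr_ge0// ltW.
  by rewrite invfM -mulrA mulKf ?gt_eqF// mulrC.
(* [x] equals [(z - l)^-1 *: S x] up to an element of the range of [T'], and [S x] is killed by a
   lower power. *)
have Nr n : ker (bop_exp S n) `<=` range T'.
  elim: n => [|n IH] x kx; first by rewrite (kx : x = 0); exact: subsp0.
  have zl' : z - l != 0 by rewrite subr_eq0.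
  have -> : x = T' (- (z - l)^-1 *: x) + (z - l)^-1 *: S x.
    rewrite bopZ TE scalerBr !scaleNr scalerA mulVf// scale1r opprK.
    by rewrite addrC addrA subrr add0r.
  apply: (subspD sR); first by exists (- (z - l)^-1 *: x).
  by apply: (subspZ _ sR); apply: IH; rewrite /Defs.ker /mkset -bop_expSr.
apply/seteqP; split=> // x _.
have [u Du Nxu] : sumsp D N x by rewrite ND.
by rewrite -(subrK u x); apply: subspD => //; [exact: Nr Nxu|exact: Dr].
Qed.

End AscentDescent.

(** * Upper triangular operators *)

Section UpperTriangular.
Variables (R : realType) (X : normedModType R[i]).
Implicit Types (A B C : bop X X).
Local Notation XX := (X * X)%type.

Let zero_X := @subsp_zero _ X.
Let zero_XX := @subsp_zero _ XX.

Definition in1 (x : X) : XX := (x, 0).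

Lemma in1_linear : linear in1.
Proof.
by move=> a x y; rewrite -[RHS]/(a *: x + y, a *: 0 + 0) scaler0 addr0.
Qed.

Section Blocks.
Variables A C B : bop X X.
Let M := upper_tri A C B.

Lemma upper_triE p : M p = (A p.1 + C p.2, B p.2). Proof. by []. Qed.

Lemma ker_upper_triP p : ker M p <-> A p.1 + C p.2 = 0 /\ B p.2 = 0.
Proof.
by rewrite /Defs.ker /mkset upper_triE; split=> [[-> ->]|[-> ->]].
Qed.

(* ker M is an extension of [kerC] by ker A, X^2 / range M is one of X / range B by
   X / [ranC], and C induces ker B / kerC = ranC / range A. *)
Definition kerC : set X := [set y | ker B y /\ range A (C y)].
Definition ranC : set X := sumsp (range A) (C @` ker B).

Lemma subsp_kerC : subsp kerC.
Proof.
apply: subspI; first exact: subsp_ker.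
exact: (subsp_preimage (bop_linear C) (subsp_range A)).
Qed.

Lemma subsp_ranC : subsp ranC.
Proof.
apply: subsp_sumsp; first exact: subsp_range.
exact: (subsp_image (bop_linear C) (subsp_ker B)).
Qed.

Lemma range_ranC : range A `<=` ranC.
Proof. by apply: sumspl; exact: (subsp_image (bop_linear C) (subsp_ker B)). Qed.

Let kerA1 : set XX := [set p | A p.1 = 0 /\ p.2 = 0].

Let sub_kerA1 : subsp kerA1.
Proof.
split=> [|a [x1 x2] [y1 y2] [/= Ax ->] [/= Ay ->]]; first by split=> //=; exact: bop0.
by split; rewrite /= ?bopD ?bopZ ?Ax ?Ay scaler0 addr0.
Qed.

Let kerA1_ker : kerA1 `<=` ker M.
Proof. by move=> [x y] [/= Ax ->]; apply/ker_upper_triP => /=; rewrite Ax !bop0 addr0. Qed.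

Let kerA1P n : qdim kerA1 [set 0] n <-> qdim (ker A) [set 0] n.
Proof.
apply: (qdim_iso (f := fst) (fun _ _ _ => erefl)) => //.
- by move=> p [].
- by move=> x Ax; exists (x, 0); rewrite /= ?subrr.
- by move=> [x y] [/= _ ->]; split=> [->|[]].
Qed.

Let kerMP n : qdim (ker M) kerA1 n <-> qdim kerC [set 0] n.
Proof.
apply: (qdim_iso (f := snd) (fun _ _ _ => erefl)) => //.
- move=> p /ker_upper_triP[Ap Bp]; split=> //; exists (- p.1) => //.
  by rewrite bopN; apply/eqP; rewrite eq_sym -addr_eq0 addrC Ap.
- move=> y [By [x _ xy]]; exists (- x, y); last by rewrite /= subrr.
  by apply/ker_upper_triP; rewrite /= bopN xy addNr.
- move=> p /ker_upper_triP[Ap Bp]; split=> [p2|[]//]; split=> //.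
  by move: Ap; rewrite (p2 : p.2 = 0) bop0 addr0.
- exact: subsp_ker.
Qed.

Lemma qdim_ker_upper_tri a e : qdim (ker A) [set 0] a -> qdim kerC [set 0] e ->
  qdim (ker M) [set 0] (e + a).
Proof.
move=> /kerA1P qa /kerMP qe; apply: qdim_add qe qa => //.
by move=> _ ->; exact: subsp0.
Qed.

Lemma qdim_ker_upper_tri_sub m : qdim (ker M) [set 0] m -> exists a e,
  [/\ qdim (ker A) [set 0] a, qdim kerC [set 0] e & (e + a = m)%N].
Proof.
move=> /(qdim_sub (subsp_ker M) sub_kerA1 zero_XX)[||e [a [/kerMP qe /kerA1P qa ea]]] //.
  by move=> _ ->; exact: subsp0.
by exists a, e.
Qed.

Let ranB2 : set XX := [set p | range B p.2].

Let sub_ranB2 : subsp ranB2.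
Proof.
split=> [|a p q Bp Bq]; first exact: subsp0 (subsp_range B).
by case: (subsp_range B) => _; apply.
Qed.

Let range_ranB2 : range M `<=` ranB2.
Proof. by move=> _ [p _ <-]; exists p.2. Qed.

Let ranB2P n : qdim setT ranB2 n <-> qdim setT (range B) n.
Proof.
apply: (qdim_iso (f := snd) (fun _ _ _ => erefl)) => //; first exact: subsp_range.
by move=> y _; exists (0, y); rewrite //= subrr; exact: subsp0 (subsp_range B).
Qed.

Let ranMP n : qdim setT ranC n <-> qdim ranB2 (range M) n.
Proof.
apply: (qdim_iso in1_linear) => //; first exact: subsp_range.
- by move=> x _; exact: subsp0 (subsp_range B).
- move=> [p q] [y _ /= By]; exists (p - C y) => //; exists (0, y) => //.
  rewrite -[RHS]/(p - (p - C y), q - 0) /= bop0 add0r By.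
  by congr pair; rewrite ?subr0// subKr.
- move=> x _; split=> [[[u v] _]|[y [u _ uy] [v Bv vy]]].
    rewrite upper_triE /= => -[xE Bv]; exists (A u); first by exists u.
    by exists v => //; rewrite -xE addrAC subrr add0r.
  by exists (u, v) => //; rewrite upper_triE /= (Bv : B v = 0) uy vy addrC subrK.
Qed.

Lemma qdim_range_upper_tri d g : qdim setT (range B) d -> qdim setT ranC g ->
  qdim setT (range M) (d + g).
Proof.
by move=> /ranB2P qd /ranMP qg; apply: qdim_add qd qg => //; exact: subsp_range.
Qed.

Lemma qdim_range_upper_tri_sub m : qdim setT (range M) m -> exists d g,
  [/\ qdim setT (range B) d, qdim setT ranC g & (d + g = m)%N].
Proof.
move=> /(qdim_sub (@subspT _ XX) sub_ranB2 (subsp_range M) range_ranB2)[//|d [g]].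
by move=> [/ranB2P qd /ranMP qg dg]; exists d, g.
Qed.

Lemma qdim_kerC n : qdim (ker B) kerC n <-> qdim ranC (range A) n.
Proof.
apply: (qdim_iso (bop_linear C)); [exact: subsp_range| | | |exact: subsp_ker].
- move=> y By; apply: sumspr; [exact: subsp_range|by exists y].
- move=> x [y Ay [v Bv vE]]; exists v => //.
  by rewrite -[X in range A X]/(x - C v) vE subKr.
- by move=> y By; split=> [|[]].
Qed.

(** Additivity of the index, written without subtraction. The isomorphism of [qdim_kerC] passes
    finiteness between [ker B] and the cokernel of [A]. *)
Lemma upper_tri_index m1 m2 :
  qdim (ker M) [set 0] m1 -> qdim setT (range M) m2 ->
  qfin setT (range A) \/ qfin (ker B) [set 0] -> exists a b c d,
  [/\ qdim (ker A) [set 0] a, qdim setT (range A) b, qdim (ker B) [set 0] c,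
      qdim setT (range B) d & (m1 + b + d = m2 + a + c)%N].
Proof.
move=> /qdim_ker_upper_tri_sub[a [e [qa qe <-]]].
move=> /qdim_range_upper_tri_sub[d [g [qd qg <-]]].
have kB : kerC `<=` ker B by move=> y [].
have [sA sB] := (subsp_range A, subsp_ker B).
have zk : [set 0] `<=` kerC by move=> _ ->; exact: subsp0 subsp_kerC.
move=> [[b qb]|[c qc]].
  have [//|g' [h [qg' qh gh]]] := qdim_sub (@subspT _ X) subsp_ranC sA range_ranC _ qb.
  have qc := qdim_add subsp_kerC zk kB zero_X ((qdim_kerC h).2 qh) qe.
  exists a, b, (h + e)%N, d; split=> //.
  rewrite -gh (qdim_uniq subsp_ranC qg' qg).
  by lia.
have [h [e' [qh qe' he]]] := qdim_sub sB subsp_kerC zero_X zk kB qc.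
have qb := qdim_add subsp_ranC range_ranC (@subsetT _ ranC) sA qg ((qdim_kerC h).1 qh).
exists a, (g + h)%N, c, d; split=> //.
by rewrite -he (qdim_uniq zero_X qe' qe); lia.
Qed.

Lemma upper_tri_index_of a b c d :
  qdim (ker A) [set 0] a -> qdim setT (range A) b -> qdim (ker B) [set 0] c ->
  qdim setT (range B) d -> exists m1 m2,
  [/\ qdim (ker M) [set 0] m1, qdim setT (range M) m2 & (m1 + b + d = m2 + a + c)%N].
Proof.
move=> qa qb qc qd.
have kB : kerC `<=` ker B by move=> y [].
have zk : [set 0] `<=` kerC by move=> _ ->; exact: subsp0 subsp_kerC.
have [sA sB] := (subsp_range A, subsp_ker B).
have [h [e [qh qe he]]] := qdim_sub sB subsp_kerC zero_X zk kB qc.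
have [//|g [h' [qg qh' gh]]] := qdim_sub (@subspT _ X) subsp_ranC sA range_ranC _ qb.
have hh : h = h' by exact: qdim_uniq sA ((qdim_kerC h).1 qh) qh'.
exists (e + a)%N, (d + g)%N; split.
- exact: qdim_ker_upper_tri.
- exact: qdim_range_upper_tri.
- by rewrite -he -gh hh; lia.
Qed.

Lemma ker_upper_tri0 : ker A = [set 0] -> ker B = [set 0] -> ker M = [set 0].
Proof.
move=> kA kB; apply/seteqP; split=> [|_ ->]; last exact: subsp0 (subsp_ker M).
move=> [x y] /ker_upper_triP[/= + By].
have : ker B y by [].
rewrite kB => ->; rewrite bop0 addr0 => Ax.
by have : ker A x by []; rewrite kA => ->.
Qed.

Lemma range_upper_triT : range A = setT -> range B = setT -> range M = setT.
Proof.
move=> rA rB; apply/seteqP; split=> // -[p q] _.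
have [y _ yq] : range B q by rewrite rB.
have [x _ xp] : range A (p - C y) by rewrite rA.
by exists (x, y) => //; rewrite upper_triE /= xp yq subrK.
Qed.

Lemma ker_upper_left0 : ker M = [set 0] -> ker A = [set 0].
Proof.
move=> kM; apply/seteqP; split=> [x Ax|_ ->]; last exact: subsp0 (subsp_ker A).
suff : ker M (x, 0) by rewrite kM => -[].
by apply/ker_upper_triP; rewrite /= (Ax : A x = 0) !bop0 addr0.
Qed.

Lemma range_lower_rightT : range M = setT -> range B = setT.
Proof.
move=> rM; apply/seteqP; split=> // q _.
have [p _ pq] : range M (0, q) by rewrite rM.
by exists p.2 => //; have := congr1 snd pq.
Qed.

Lemma ker_lower_right0 : ker M = [set 0] -> C @` ker B `<=` range A ->
  ker B = [set 0].
Proof.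
move=> kM CA; apply/seteqP; split=> [y By|_ ->]; last exact: subsp0 (subsp_ker B).
have [|x _ xy] := CA (C y); first by exists y.
suff : ker M (- x, y) by rewrite kM => -[].
by apply/ker_upper_triP; rewrite /= bopN xy addNr.
Qed.

Hypothesis cX : geom_complete X.

(** On the closed subspace of pairs [(x, 0)] the matrix acts as [A], and [closed_image] applies to
    this subspace. *)
Lemma closed_range_upper_left : closed (range M) -> qfin (ker M) [set 0] ->
  closed (range A).
Proof.
move=> cM fM.
pose W : set XX := [set p | p.2 = 0].
have sW : subsp W.
  split=> [//|a p q p2 q2]; rewrite /W /mkset -[LHS]/(a *: p.2 + q.2).
  by rewrite (p2 : p.2 = 0) (q2 : q.2 = 0) scaler0 addr0.
have cW : closed W.
  apply/closed_nr => p ph; apply: nr_small => e e0; have [q q2 pq] := ph e e0.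
  apply/ltW/(le_lt_trans _ pq).
  have : nr (p - q) <= nr (p - q) by [].
  by rewrite nr_pairP => /andP[_]; rewrite /= (q2 : q.2 = 0) subr0.
have := closed_image (prod_geom_complete cX cX) cM fM sW cW.
move/closed_nr => h; apply/closed_nr => y yh.
have [|[u v] /= v0 /(congr1 fst) /= uy] := h (in1 y).
  move=> e /yh[_ [x _ <-] yx]; exists (in1 (A x)).
    by exists (x, 0) => //; rewrite upper_triE /= !bop0 addr0.
  rewrite nr_pair /= subrr nr0; case: (lerP (nr (y - A x)) 0) => // h0.
  exact: le_lt_trans (nr_ge0 _) yx.
by exists u => //; move: uy; rewrite (v0 : v = 0) bop0 addr0.
Qed.

End Blocks.

Lemma kerC0 A B : kerC A 0 B = ker B.
Proof. by apply/seteqP; split=> [y []//|y By]; split=> //; exists 0; rewrite // bop0. Qed.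

Lemma ker_diag0 A B : ker (upper_tri A 0 B) = [set 0] -> ker B = [set 0].
Proof.
move=> k0; apply: (ker_lower_right0 k0) => _ [y _ <-].
by exists 0; rewrite // bop0.
Qed.

Lemma sub_scalar_upper_tri A B C l :
  sub_scalar (upper_tri A C B) l = upper_tri (sub_scalar A l) C (sub_scalar B l).
Proof.
apply: bop_ext => -[x y].
rewrite upper_triE !sub_scalarE upper_triE /=; congr pair.
by rewrite addrAC.
Qed.

End UpperTriangular.

(** * Weyl operators and isolated points of the spectrum *)

Section Weyl.
Variables (R : realType) (Y : normedModType R[i]).
Implicit Types (T : bop Y Y).

Lemma weylP T : weyl T <-> closed (range T) /\
  exists n, qdim (ker T) [set 0] n /\ qdim setT (range T) n.
Proof.
split=> [[[[cT /finite_dimE[n kn]] [_ /finite_codimE[m rm]]]]|[cT [n [kn rn]]]].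
  rewrite /Defs.ind /alpha /beta (dimE (subsp_ker T) kn) (codimE (subsp_range T) rm).
  by move/eqP; rewrite subr_eq0 => /eqP[nm]; split=> //; exists n; rewrite {2}nm.
split; first by split; split=> //; [apply/finite_dimE|apply/finite_codimE]; exists n.
rewrite /Defs.ind /alpha /beta (dimE (subsp_ker T) kn) (codimE (subsp_range T) rn).
by rewrite subrr.
Qed.

Lemma isolated_spectrumP T l : isolated (spectrum T) l <-> spectrum T l /\
  exists2 r, 0 < r &
    forall z, z != l -> nr (z - l) < r -> invertible (sub_scalar T z).
Proof.
split=> [[/set_mem sl [V Vl VT]]|[sl [r r0 inv]]].
  split=> //; have [r r0 rV] := (@nbhs_nr R R[i] l V).1 Vl.
  exists r => // z /eqP zl zr; apply: contrapT => nz; apply: zl.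
  have : (V `&` spectrum T) z by split=> //; apply: rV; rewrite nrC.
  by rewrite VT.
split; first exact: mem_set.
exists [set z | nr (l - z) < r]; first by apply/(@nbhs_nr R R[i]); exists r.
apply/seteqP; split=> [z [/= zr sz]|_ ->]; last by split=> //=; rewrite subrr nr0.
by apply: contrapT => /eqP zl; apply: sz; apply: inv => //; rewrite nrC.
Qed.

Lemma alpha_gt0P T : qfin (ker T) [set 0] -> (0 < alpha T)%N <-> ker T <> [set 0].
Proof.
move=> [n kn]; rewrite /alpha (dimE (subsp_ker T) kn); split=> [n0 k0|k0].
  have z0 := @subsp_zero _ Y.
  have : qdim (ker T) [set 0] 0 by apply: qdim0; rewrite ?k0.
  by move=> /(qdim_uniq z0 kn) n00; rewrite n00 in n0.
rewrite lt0n; apply/eqP => n0; rewrite n0 in kn; apply: k0.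
apply/seteqP; split=> [|_ ->]; first exact: qdim0_sub kn.
exact: subsp0 (subsp_ker T).
Qed.

End Weyl.

(** * Weyl's theorem for upper triangular operators *)

Section Main.
Variables (R : realType) (X : completeNormedModType R[i]).
Implicit Types (A B C : bop X X).

Let cX : geom_complete X := @complete_geom_complete R X.
Let cXX : geom_complete (X * X)%type := prod_geom_complete cX cX.

(* A and B are Fredholm and ind A + ind B = 0, a condition that does not involve C. *)
Definition diag_weyl A B := exists a b c d,
  [/\ qdim (ker A) [set 0] a, qdim setT (range A) b, qdim (ker B) [set 0] c,
      qdim setT (range B) d & (a + c = b + d)%N].

Lemma diag_weyl_upper A B C : diag_weyl A B -> weyl (upper_tri A C B).
Proof.
move=> [a [b [c [d [qa qb qc qd e]]]]]; apply/weylP.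
have [m1 [m2 [q1 q2 m12]]] := upper_tri_index_of C qa qb qc qd.
have mm : m1 = m2 by move: m12 e; lia.
split; first by apply: closed_range_cofinite => //; exists m2.
by exists m1; split=> //; rewrite mm.
Qed.

Lemma weyl_upper_diag A B C : weyl (upper_tri A C B) ->
  qfin setT (range A) \/ qfin (ker B) [set 0] -> diag_weyl A B.
Proof.
move=> /weylP[_ [n [kn rn]]] /(upper_tri_index kn rn)[a [b [c [d [qa qb qc qd e]]]]].
by exists a, b, c, d; split=> //; move: e; lia.
Qed.

(** For [C = 0] the space [kerC] is all of [ker B], which is thus finite-dimensional. *)
Lemma weyl_diagP A B : weyl (upper_tri A 0 B) <-> diag_weyl A B.
Proof.
split=> [w|]; last exact: diag_weyl_upper.
apply: (weyl_upper_diag w); right.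
have /weylP[_ [n [/qdim_ker_upper_tri_sub[a [e [_ + _]]] _]]] := w.
by rewrite kerC0; exists e.
Qed.

Lemma invertible_diag A B : invertible (upper_tri A 0 B) -> invertible A /\ invertible B.
Proof.
move=> /(invertibleP cXX)[kM rM].
split; apply/(invertibleP cX); split.
- exact: ker_upper_left0 kM.
- apply/seteqP; split=> // p _.
  have [q _ pq] : range (upper_tri A 0 B) (p, 0) by rewrite rM.
  by exists q.1 => //; have := congr1 fst pq; rewrite upper_triE /= addr0.
- exact: ker_diag0 kM.
- exact: range_lower_rightT rM.
Qed.

Lemma invertible_upper A B C : invertible A -> invertible B ->
  invertible (upper_tri A C B).
Proof.
move=> /(invertibleP cX)[kA rA] /(invertibleP cX)[kB rB]; apply/(invertibleP cXX).
by split; [exact: ker_upper_tri0|exact: range_upper_triT].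
Qed.

Section Fixed.
Variables A B : bop X X.
Local Notation M C := (upper_tri A C B).

Lemma spectrum_upper_diag C l : spectrum (M C) l -> spectrum (M 0) l.
Proof.
move=> sC; rewrite /spectrum /mkset sub_scalar_upper_tri => /invertible_diag[iA iB].
by apply: sC; rewrite sub_scalar_upper_tri; exact: invertible_upper.
Qed.

Lemma not_sigma_wP C l : ~ sigma_w (M C) l <->
  weyl (upper_tri (sub_scalar A l) C (sub_scalar B l)).
Proof. by rewrite -sub_scalar_upper_tri; split=> [/contrapT|w]. Qed.

Lemma isolated_upper_of_diag C l : isolated (spectrum (M 0)) l -> spectrum (M C) l ->
  isolated (spectrum (M C)) l.
Proof.
move=> /isolated_spectrumP[_ [r r0 inv]] sC; apply/isolated_spectrumP; split=> //.
exists r => // z zl zr; apply: contrapT => /spectrum_upper_diag; apply.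
exact: inv.
Qed.

(** This is the form in which conditions (i)-(iii) enter; it is derived from them in
    [theorem3p7]. *)
Hypothesis AB : forall C l, ~ sigma_w (M C) l ->
  diag_weyl (sub_scalar A l) (sub_scalar B l).

Lemma sigma_wE C l : sigma_w (M C) l <-> sigma_w (M 0) l.
Proof.
split=> sC; apply: contrapT => /AB/diag_weyl_upper w.
  by have := w C; rewrite -not_sigma_wP.
by have := w 0; rewrite -not_sigma_wP.
Qed.

Lemma weyl_theorem_polaroid C l : weyl_theorem (M 0) -> weyl_theorem (M C) ->
  pi0 (M C) l -> polaroid_at A l.
Proof.
move=> w0 wC; rewrite -wC => -[sl /[dup] nw /AB[a [b [c [d [qa qb _ _ _]]]]]].
have : pi0 (M 0) l.
  by rewrite -w0; split; [exact: spectrum_upper_diag sl|move=> /(sigma_wE C l).2/nw].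
move=> [/isolated_spectrumP[_ [r r0 inv]] _].
apply: (isolated_fredholm_polaroid cX r0); [|by exists a|by exists b].
by move=> z zl zr; have := inv z zl zr; rewrite sub_scalar_upper_tri => /invertible_diag[].
Qed.

Lemma pi0_of_weyl C l : weyl_theorem (M 0) -> spectrum (M C) l -> ~ sigma_w (M C) l ->
  pi0 (M C) l.
Proof.
move=> w0 sl nw.
have [iso0 _] : pi0 (M 0) l.
  by rewrite -w0; split; [exact: spectrum_upper_diag sl|move=> /(sigma_wE C l).2/nw].
have /weylP[_ [n [kn rn]]] : weyl (sub_scalar (M C) l) by exact: contrapT.
split; first exact: isolated_upper_of_diag.
have fk := qdim_qfin kn; split; first exact/finite_dimE.
(* A zero kernel would, the index being 0, make the operator invertible. *)
apply/alpha_gt0P => // k0; apply: sl; apply/(invertibleP cXX); split=> //.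
have n0 : n = 0%N.
  by apply: (qdim_uniq (@subsp_zero _ _) kn); apply: qdim0; rewrite ?k0.
by apply/seteqP; split=> //; apply: qdim0_sub; rewrite -n0.
Qed.

(** It suffices to place [l] in [pi0 (M 0)], since [M 0] satisfies Weyl's theorem and the Weyl
    spectra agree. *)
Lemma weyl_of_pi0 C l : weyl_theorem (M 0) -> pi0 (M C) l -> polaroid_at A l ->
  ~ sigma_w (M C) l.
Proof.
move=> w0 [/isolated_spectrumP[sl [r r0 inv]] [/finite_dimE fk ak]] pA.
have := fk; rewrite sub_scalar_upper_tri => -[m /qdim_ker_upper_tri_sub[a [e [qa qe _]]]].
have [[b qb] [r' r'0 surj]] := polaroid_surjective cX pA (qdim_qfin qa).
have sC := subsp_kerC (sub_scalar A l) C (sub_scalar B l).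
set A' := sub_scalar A l in qa qb qe sC *; set B' := sub_scalar B l in qe sC *.
have [//|g [h [_ qh _]]] := qdim_sub (@subspT _ X) (subsp_ranC A' C B')
  (subsp_range A') (@range_ranC _ _ A' C B') _ qb.
(* The finite cokernel of [A'] makes ranC / range A' finite-dimensional, which is ker B' / kerC. *)
have qB : qdim (ker B') [set 0] (h + e).
  have zk : [set 0] `<=` kerC A' C B' by move=> _ ->; exact: subsp0 sC.
  have kB : kerC A' C B' `<=` ker B' by move=> y [].
  exact: qdim_add sC zk kB (@subsp_zero _ X) ((qdim_kerC A' C B' h).2 qh) qe.
suff : pi0 (M 0) l.
  by rewrite -w0 => -[_ n0] sw; apply: n0; exact: (sigma_wE C l).1.
have q0 : qdim (ker (sub_scalar (M 0) l)) [set 0] (h + e + a).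
  by rewrite sub_scalar_upper_tri; apply: qdim_ker_upper_tri; rewrite ?kerC0.
split; last first.
  have f0 := qdim_qfin q0; split; first exact/finite_dimE.
  apply/(alpha_gt0P f0) => k0.
  have /alpha_gt0P := ak; move=> /(_ fk); apply.
  move: k0; rewrite !sub_scalar_upper_tri => k0.
  exact: ker_upper_tri0 (ker_upper_left0 k0) (ker_diag0 k0).
apply/isolated_spectrumP; split; first exact: spectrum_upper_diag sl.
(* For [z] this close, [A - z] is injective because the matrix is, and surjective by the polaroid
   property; bijectivity of [B - z] follows. *)
exists (Num.min r r'); first by rewrite lt_min r0.
move=> z zl; rewrite lt_min => /andP[zr zr'].
have := inv z zl zr; rewrite sub_scalar_upper_tri => /(invertibleP cXX)[kM rM].
have rA := surj z zl zr'.
rewrite sub_scalar_upper_tri; apply: invertible_upper; apply/(invertibleP cX); split.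
- exact: ker_upper_left0 kM.
- exact: rA.
- by apply: (ker_lower_right0 kM); rewrite rA.
- exact: range_lower_rightT rM.
Qed.

Lemma weyl_theorem_upperP : (forall C, weyl_theorem (M C)) <->
  weyl_theorem (M 0) /\ (forall C l, pi0 (M C) l -> polaroid_at A l).
Proof.
split=> [w|[w0 pol] C].
  by split=> [//|C l]; exact: weyl_theorem_polaroid.
apply/seteqP; split=> [l [sl nw]|l pl]; first exact: pi0_of_weyl.
split; first by case: (pl) => /isolated_spectrumP[].
exact: weyl_of_pi0 (pol C l pl).
Qed.

End Fixed.
End Main.

Theorem theorem3p7 (R : realType) (X : completeNormedModType R[i])
  (A B : bop X X) :
  let M (C : bop X X) := upper_tri A C B in
  [\/ (forall lambda, (sigma_w (M 0) `\` sigma_SF_plus A) lambda ->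
          SVEP_at A lambda) /\
      (forall mu, (sigma_w (M 0) `\` sigma_SF_minus B) mu -> SVEP_at B mu),
      (forall lambda, (sigma_w (M 0) `\` sigma_SF_plus A) lambda ->
          SVEP_at A lambda /\ SVEP_at (adjoint A) lambda) |
      (forall lambda, (sigma_w (M 0) `\` sigma_SF_plus A) lambda ->
          SVEP_at (adjoint A) lambda) /\
      (forall mu, (sigma_w (M 0) `\` sigma_SF_minus B) mu ->
          SVEP_at (adjoint B) mu)] ->
  ((forall C : bop X X, weyl_theorem (M C)) <->
   weyl_theorem (M 0) /\
   (forall (C : bop X X) lambda, pi0 (M C) lambda -> polaroid_at A lambda)).
Proof.
move=> M svep; apply: weyl_theorem_upperP => C l.
have cX := @complete_geom_complete R X.
move=> /not_sigma_wP w; have /weylP[cM [n [kn rn]]] := w.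
have [a [_ [qa _ _]]] := qdim_ker_upper_tri_sub kn.
have [d [_ [qd _ _]]] := qdim_range_upper_tri_sub rn.
have cA := closed_range_upper_left cX cM (qdim_qfin kn).
have cB := closed_range_cofinite cX (qdim_qfin qd).
(* Arguing by contradiction puts [l] in the Weyl spectrum of [M 0], while [l] avoids both
   semi-Fredholm spectra, so the SVEP conditions apply at [l]. *)
apply: contrapT => nAB.
have s0 : sigma_w (M 0) l by move=> w0; apply: nAB; apply/weyl_diagP; rewrite -sub_scalar_upper_tri.
have sA : ~ sigma_SF_plus A l by apply; split=> //; apply/finite_dimE; exists a.
have sB : ~ sigma_SF_minus B l by apply; split=> //; apply/finite_codimE; exists d.
apply: nAB; apply: (weyl_upper_diag w).
have adjA : SVEP_at (adjoint A) l -> qfin setT (range (sub_scalar A l)).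
  by move=> /SVEP_svep_near/(svep_adjoint cX)/(_ cA qa)[s [_ [qs _]]]; exists s.
(* Conditions (ii) and (iii) give a finite cokernel of [A - l] through the adjoint; condition (i)
   gives a finite-dimensional kernel of [B - l]. *)
case: svep => [[_ hB]|hA|[hA _]]; last 2 first.
- by left; apply: adjA; apply: (hA l _).2.
- by left; apply: adjA; apply: hA.
right.
have [|k [s [_ [_ qs _ _]]]] := svep_range_cofinite cX (SVEP_svep_near (hB l _)) (qdim_qfin qd).
  by [].
by exists s.
Qed.
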